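(* Let $d\geq2$, $s\in(0,1/2)$ and $q>\frac{d}{2s}$. Let $\Omega\subset\mathbb{R}^d$ be a bounded domain with Lipschitz boundary satisfying the exterior ball condition, and let $D\subset\Omega$ be an open set with Lipschitz boundary such that $\inf_{x\in\partial D}d(x,\partial\Omega)>0$, where $\partial D$ is the boundary of $D$ in $\mathbb{R}^d$. For $\alpha>0$ and $n\in L^2(\Omega)$ let $u_{\alpha,n}$ be the unique minimizer over $H^s_0(\overline\Omega)$ of $$u\mapsto\int_\Omega\big(u(x)-\mathbf{1}_D(x)-n(x)\big)^2\,dx+\alpha\,|u|_{H^s}^2 .$$ Consider a sequence of pairs $(\alpha,n)$ with $\alpha\to0^+$, $n\in L^2(\Omega)\cap L^q(\Omega)$, $\|n\|_{L^2(\Omega)}\to0$ and $\|n\|_{L^q(\Omega)}/\alpha\to0$. Then there are a constant $C(\Omega,D)>0$, independent of $\theta$ and $\alpha$, and, for each $\theta\in(0,1)$, a constant $\alpha_0(\Omega,D,\theta)>0$ such that for every $\theta\in(0,1)$ $$d_H\big(\partial\{u_{\alpha,n}>\theta\},\partial D\big)\leq C(\Omega,D)\,\max\left(\frac1\theta,\ \frac1{1-\theta}\right)^{\min(2/d,\,1/(2s))}\alpha^{1/d}$$ for all pairs $(\alpha,n)$ of the sequence with $\alpha\leq\alpha_0(\Omega,D,\theta)$.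
   Context: For measurable $u:\mathbb{R}^d\to\mathbb{R}$, $|u|_{H^s}^2:=\int_{\mathbb{R}^d}\int_{\mathbb{R}^d}\frac{|u(x)-u(y)|^2}{|x-y|^{d+2s}}\,dx\,dy$, always computed on the whole space. $H^s_0(\overline\Omega):=\{u:\mathbb{R}^d\to\mathbb{R}\mid u=0\text{ on }\mathbb{R}^d\setminus\Omega,\ |u|_{H^s}<+\infty\}$. Functions in $L^p(\Omega)$ are identified with their extension by zero to $\mathbb{R}^d$. $\mathbf{1}_D$ is the function equal to $1$ on $D$ and $0$ on $D^c$. Exterior ball condition: there is a radius such that every point of $\partial\Omega$ can be touched by a ball of this radius contained in $\mathbb{R}^d\setminus\Omega$. $d(x,E):=\inf_{y\in E}|x-y|$, and $d_H(E,F):=\max\big(\sup_{x\in E}d(x,F),\ \sup_{y\in F}d(y,E)\big)$ is the Hausdorff distance. Level sets $\{u_{\alpha,n}>\theta\}\subset\mathbb{R}^d$ are those of the representative of $u_{\alpha,n}$ that is continuous in $\Omega$ (the minimizers are locally Hölder continuous in $\Omega$) and zero outside $\Omega$. The quantities $d$, $s$, $q$ and the sequence of pairs $(\alpha,n)$ are fixed throughout; the dependence of the constants on them is not indicated in the notation. *)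

(* Defs.v *)
From HB Require Import structures.
From mathcomp Require Import all_boot all_order all_algebra.
From mathcomp Require Import all_classical all_reals all_analysis.

Set Implicit Arguments.
Unset Strict Implicit.
Unset Printing Implicit Defensive.

Import Order.TTheory GRing.Theory Num.Theory.
Import numFieldNormedType.Exports.

Local Open Scope classical_set_scope.
Local Open Scope ring_scope.

(** Row vectors carry the product sigma-algebra, as the library does for
    tuples; over [R : realType] this is the Borel sigma-algebra of ['rV[R]_n].
    Working with Borel functions loses nothing, since every class of Lebesgue
    measurable functions modulo null sets has a Borel representative. *)
Definition measure_rV_display : measure_display -> measure_display.
Proof. exact. Qed.

Section measurable_rV.
Context {d} {T : sigmaRingType d}.
Variable n : nat.

Definition rV_coord (i : 'I_n) (x : 'rV[T]_n) : T := x ord0 i.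

Let rV_set0 : g_sigma_preimage rV_coord set0.
Proof. exact: sigma_algebra0. Qed.

Let rV_setC A : g_sigma_preimage rV_coord A ->
  g_sigma_preimage rV_coord (~` A).
Proof. exact: sigma_algebraC. Qed.

Let rV_bigcup (F : _^nat) : (forall i, g_sigma_preimage rV_coord (F i)) ->
  g_sigma_preimage rV_coord (\bigcup_i (F i)).
Proof. exact: sigma_algebra_bigcup. Qed.

HB.instance Definition _ := @isMeasurable.Build (measure_rV_display d)
  'rV[T]_n (g_sigma_preimage rV_coord) rV_set0 rV_setC rV_bigcup.

End measurable_rV.

Lemma measurable_fun_rVP d1 d2 (T1 : measurableType d1)
    (T2 : measurableType d2) n (f : T1 -> 'rV[T2]_n) :
  measurable_fun [set: T1] f <->
  forall i, measurable_fun [set: T1] (fun x => f x ord0 i).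
Proof.
apply: (@iff_trans _ (g_sigma_preimage
    (fun i => @rV_coord _ T2 n i \o f) `<=` measurable)).
  rewrite g_sigma_preimage_comp; split=> [mf A [/= C preC <-]|prefS].
    exact: mf.
  by move=> _ A mA; apply: prefS; exists A.
split=> [fS i|mf].
- move=> _ A mA; apply: fS; apply: sub_sigma_algebra.
  case: n i => [[] []//|n i] in f *.
  rewrite -bigcup_mkord_ord.
  exists i; first exact: ltn_ord.
  by exists A => //; rewrite inord_val.
- apply: smallest_sub; first exact: sigma_algebra_measurable.
  case: n => [|n] in f mf *; first by rewrite big_ord0.
  rewrite -bigcup_mkord_ord; apply: bigcup_sub => i Ii.
  by move=> A [B mB <-]; exact: mf.
Qed.

Section lebesgue_rV.
Context {R : realType}.
Implicit Types n : nat.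

Definition rV_cons n (p : R * 'rV[R]_n) : 'rV[R]_n.+1 :=
  row_mx (p.1%:M : 'rV[R]_1) p.2.

Definition rV_uncons n (v : 'rV[R]_n.+1) : R * 'rV[R]_n :=
  (v ord0 ord0, rsubmx (v : 'rV[R]_(1 + n))).

Lemma rV_consK n : cancel (@rV_cons n) (@rV_uncons n).
Proof.
move=> [x v]; rewrite /rV_cons /rV_uncons /= row_mxKr; congr pair.
rewrite -[RHS](_ : row_mx (x%:M : 'rV[R]_1) v ord0 (lshift n (ord0 : 'I_1)) = x).
  by congr (row_mx _ _ _ _); exact: val_inj.
by rewrite row_mxEl mxE eqxx mulr1n.
Qed.

Lemma measurable_rV_cons n : measurable_fun [set: R * 'rV[R]_n] (@rV_cons n).
Proof.
apply/measurable_fun_rVP => i; rewrite /rV_cons.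
under eq_fun do rewrite mxE.
case: (fintype.split (i : 'I_(1 + n))) => j.
- by under eq_fun do rewrite mxE (ord1 j) eqxx mulr1n; exact: measurable_fst.
- have /measurable_fun_rVP/(_ j) : measurable_fun setT (@id 'rV[R]_n).
    exact: measurable_id.
  by move=> m; exact: (measurableT_comp m measurable_snd).
Qed.

Lemma measurable_rV_uncons n : measurable_fun [set: 'rV[R]_n.+1] (@rV_uncons n).
Proof.
have /measurable_fun_rVP mid : measurable_fun setT (@id 'rV[R]_n.+1).
  exact: measurable_id.
apply/measurable_fun_pairP; split; first exact: mid.
apply/measurable_fun_rVP => j.
by under eq_fun do rewrite /= mxE; exact: mid.
Qed.

Definition lebesgue_rVS n (mu : set 'rV[R]_n -> \bar R) :
    set 'rV[R]_n.+1 -> \bar R :=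
  pushforward (lebesgue_measure \x mu)%E (@rV_cons n).

Section lebesgue_rVS.
Local Open Scope ereal_scope.
Variables (n : nat) (mu : {sigma_finite_measure set 'rV[R]_n -> \bar R}).

Let nu := lebesgue_rVS mu.

Let nu0 : nu set0 = 0.
Proof. by rewrite /nu /lebesgue_rVS /pushforward preimage_set0 measure0. Qed.

Let nu_ge0 A : 0 <= nu A.
Proof. by rewrite /nu /lebesgue_rVS /pushforward measure_ge0. Qed.

Let nu_semi_sigma_additive : semi_sigma_additive nu.
Proof.
move=> F mF tF mUF; rewrite /nu /lebesgue_rVS /pushforward preimage_bigcup.
apply: measure_semi_sigma_additive.
- by move=> k; rewrite -[X in measurable X]setTI; exact: measurable_rV_cons.
- apply/trivIsetP => /= i j _ _ ij; rewrite -preimage_setI.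
  by move/trivIsetP : tF => /(_ _ _ _ _ ij) ->//; rewrite preimage_set0.
- rewrite -preimage_bigcup -[X in measurable X]setTI.
  exact: measurable_rV_cons.
Qed.

HB.instance Definition _ := isMeasure.Build _ _ _ (lebesgue_rVS mu)
  nu0 nu_ge0 nu_semi_sigma_additive.

(** Proved by hand: for [\x], inference finds the instance for probability
    measures instead of the sigma-finite one. *)
Let nu_sigma_finite : sigma_finite setT nu.
Proof.
pose leb : {sigma_finite_measure set (measurableTypeR R) -> \bar R} :=
  lebesgue_measure.
have /sigma_finiteP[F [TF ndF Foo]] := sigma_finiteT leb.
have /sigma_finiteP[G [TG ndG Goo]] := sigma_finiteT mu.
exists (fun k => @rV_uncons n @^-1` (F k `*` G k)).
  rewrite -preimage_bigcup (_ : \bigcup_k _ = setT) ?preimage_setT//.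
  apply/seteqP; split=> // -[x v] _.
  have [i _ Fix] : (\bigcup_i F i) x by rewrite -TF.
  have [j _ Gjv] : (\bigcup_j G j) v by rewrite -TG.
  exists (maxn i j) => //; split.
    by move: x Fix; exact/subsetPset/ndF/leq_maxl.
  by move: v Gjv; exact/subsetPset/ndG/leq_maxr.
move=> k; have [mF Fk] := Foo k; have [mG Gk] := Goo k; split.
  rewrite -[X in measurable X]setTI; apply: measurable_rV_uncons => //.
  exact: measurableX.
rewrite /nu /lebesgue_rVS /pushforward (_ : _ @^-1` _ = F k `*` G k).
  by rewrite product_measure1E// lte_mul_pinfty// ge0_fin_numE.
rewrite -comp_preimage (_ : _ \o _ = id) ?preimage_id//.
by apply/funext => p; exact: rV_consK.
Qed.

HB.instance Definition _ := Measure_isSigmaFinite.Build _ _ _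
  (lebesgue_rVS mu) nu_sigma_finite.

End lebesgue_rVS.

(** Lebesgue measure on [R^n], through [R^(m+1) = R * R^m]; the one-point space
    [R^0] has mass 1. *)
Fixpoint lebesgue_rV n : set 'rV[R]_n -> \bar R :=
  match n return set 'rV[R]_n -> \bar R with
  | 0%N => \d_(0 : 'rV[R]_0)
  | m.+1 => lebesgue_rVS (@lebesgue_rV m)
  end.

Section lebesgue_rV_measure.
Local Open Scope ereal_scope.

(** The fixpoint is over bare set functions; sigma-finiteness of the measure at
    [n] is needed to get a measure at [n.+1], hence this joint induction. *)
Lemma lebesgue_rV_exists n :
  exists mu : {sigma_finite_measure set 'rV[R]_n -> \bar R},
    mu = @lebesgue_rV n :> (set 'rV[R]_n -> \bar R).
Proof.
elim: n => [|n [mu muE]]; first by exists \d_(0%R : 'rV[R]_0).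
by exists (lebesgue_rVS mu); rewrite /= muE.
Qed.

Let leb0 n : lebesgue_rV (set0 : set 'rV[R]_n) = 0.
Proof. by have [mu <-] := lebesgue_rV_exists n; exact: measure0. Qed.

Let leb_ge0 n (A : set 'rV[R]_n) : 0 <= lebesgue_rV A.
Proof. by have [mu <-] := lebesgue_rV_exists n; exact: measure_ge0. Qed.

Let leb_semi_sigma_additive n : semi_sigma_additive (@lebesgue_rV n).
Proof.
by have [mu <-] := lebesgue_rV_exists n; exact: measure_semi_sigma_additive.
Qed.

HB.instance Definition _ n := isMeasure.Build _ _ _ (@lebesgue_rV n)
  (leb0 n) (@leb_ge0 n) (@leb_semi_sigma_additive n).

Let leb_sigma_finite n : sigma_finite setT (@lebesgue_rV n).
Proof. by have [mu <-] := lebesgue_rV_exists n; exact: sigma_finiteT. Qed.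

HB.instance Definition _ n := Measure_isSigmaFinite.Build _ _ _
  (@lebesgue_rV n) (@leb_sigma_finite n).

End lebesgue_rV_measure.

End lebesgue_rV.

Section euclidean.
Context {R : realType} {d : nat}.
Implicit Types (x y : 'rV[R]_d) (A E F Omega : set 'rV[R]_d).

Definition dotrv x y : R := \sum_i x ord0 i * y ord0 i.

(** The norm of ['rV[R]_d] in the library is the sup norm. It induces the
    same topology and bounded sets, but distances are Euclidean below. *)
Definition enorm x : R := Num.sqrt (dotrv x x).

Definition boundary A : set 'rV[R]_d := closure A `\` A°.

(** Infima and suprema are taken in [\bar R]: the distance to [set0] is [+oo],
    so [hausdorff E F] is [+oo] when exactly one of the sets is empty (and
    [-oo], hence below every bound, when both are). *)
Definition dist_set x E : \bar R :=
  ereal_inf [set (enorm (x - y))%:E | y in E].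

Definition hausdorff E F : \bar R :=
  Order.max (ereal_sup [set dist_set x F | x in E])
            (ereal_sup [set dist_set y E | y in F]).

(** Near every boundary point, [A] is the strict epigraph of a Lipschitz
    function in some rotated coordinate system. The last coordinate axis is
    spanned by the unit vector [e], so [dotrv x e] is the last coordinate of [x]
    and [x - dotrv x e *: e] is its projection on the hyperplane of the
    remaining ones; [g] only matters on that hyperplane, from which a Lipschitz
    function extends to the whole space by composition with the projection. *)
Definition lipschitz_boundary A : Prop :=
  forall x0, boundary A x0 ->
  exists (r : R) (e : 'rV[R]_d) (g : 'rV[R]_d -> R) (L : R),
    [/\ 0 < r, enorm e = 1,
        forall x y, `|g x - g y| <= L * enorm (x - y) &
        forall x, enorm (x - x0) < r ->
          (A x <-> g (x - dotrv x e *: e) < dotrv x e)].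

Definition exterior_ball_condition Omega : Prop :=
  exists2 r : R, 0 < r &
    forall x, boundary Omega x -> exists c : 'rV[R]_d,
      enorm (x - c) = r /\ [set y | enorm (y - c) < r] `<=` ~` Omega.

Definition bounded_domain Omega : Prop :=
  [/\ open Omega, connected Omega, Omega !=set0 & bounded_set Omega].

End euclidean.

Section fractional_sobolev.
Context {R : realType} {d : nat}.
Implicit Types (s : R) (Omega D : set 'rV[R]_d) (u n : 'rV[R]_d -> R).

(** On the diagonal [x = y], a null set, the integrand is [0]. *)
Definition gagliardo_sq s u : \bar R :=
  (\int[@lebesgue_rV R d]_x \int[@lebesgue_rV R d]_y
    (`|u x - u y| ^+ 2 / enorm (x - y) `^ (d%:R + 2 * s))%:E)%E.

Definition Hs0 s Omega : set ('rV[R]_d -> R) :=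
  [set u : 'rV[R]_d -> R | [/\ measurable_fun [set: 'rV[R]_d] u,
               forall x, ~ Omega x -> u x = 0 &
               (gagliardo_sq s u < +oo)%E]].

(** [L^p(Omega)], its elements being extended by zero. *)
Definition Lp_dom (p : \bar R) Omega : set ('rV[R]_d -> R) :=
  [set n : 'rV[R]_d -> R | n \in Lfun (@lebesgue_rV R d) p /\
           forall x, ~ Omega x -> n x = 0].

(** For [n] in [Lp_dom p Omega] this is the norm of [n] in [L^p(Omega)]. *)
Definition Lp_norm (p : \bar R) n : \bar R :=
  'N[@lebesgue_rV R d]_p[EFin \o n]%E.

Definition energy s Omega D (alpha : R) n u : \bar R :=
  (\int[@lebesgue_rV R d]_(x in Omega) ((u x - \1_D x - n x) ^+ 2)%:E
   + alpha%:E * gagliardo_sq s u)%E.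

Definition is_minimizer s Omega D (alpha : R) n u : Prop :=
  Hs0 s Omega u /\
  forall v, Hs0 s Omega v ->
    (energy s Omega D alpha n u <= energy s Omega D alpha n v)%E.

(** The minimizer is unique up to a null set; this singles out its
    representative continuous in [Omega] and zero outside [Omega] (the latter
    is part of [Hs0]). *)
Definition is_continuous_minimizer s Omega D (alpha : R) n u : Prop :=
  is_minimizer s Omega D alpha n u /\ {within Omega, continuous u}.

End fractional_sobolev.

(* Main.v *)
Require Import Defs.
From mathcomp Require Import all_boot all_order all_algebra.
From mathcomp Require Import all_classical all_reals all_analysis.
From mathcomp Require Import measurable_realfun ring lra.

(** For fixed [theta] and small [alpha], the length [alpha^(1/d)] is much larger
    than the natural scale [alpha^(1/(2s))] of the functional, so it suffices to
    show that [u] is uniformly close to [1], resp. [0], at the points of [Omega]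
    whose ball of radius [r = alpha^(1/d) / 2] lies in [D], resp. misses [D].

    Let [w] be a truncated cone with vertex at such a point, lifted by a constant
    of order [alpha / r] (and lowered by [1] when working with [- u]). As [s < 1/2], the integral of [|w x - w y|] against the
    kernel [|x - y|^-(d+2s)] is at most [C / r], so no second-order cancellation
    is needed for [w + k] to be a supersolution up to the noise. Comparing the
    energies of [v] ([u] or [- u]) and [min v (w + k)] gives, for
    [phi = (v - w - k)^+],
      [alpha * |phi|_{H^s}^2 <= 2 * int phi |n|].
    If [phi] vanishes outside [E], then [|phi|_{H^s}^2 >= c |E|^(-2s/d) int phi^2],
    because the kernel integrated over the complement of [E] is at least
    [c |E|^(-2s/d)]. Since [q > d/(2s)], these two bounds make Stampacchia's
    iteration on the measures of [{v > w + k}] converge, whence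
    [v <= w + C ||n||_q / alpha]. At the vertex of the cone this is the desired
    bound. The Lipschitz graphs of [D] provide, near each of its boundary points,
    balls of comparable radius inside and outside [D]; a segment joining their
    centers meets the boundary of [{u > theta}]. *)

Set Implicit Arguments.
Unset Strict Implicit.
Unset Printing Implicit Defensive.

Import Order.TTheory GRing.Theory Num.Theory.
Import numFieldNormedType.Exports.

Local Open Scope classical_set_scope.
Local Open Scope ring_scope.

(** * Lebesgue measure on row vectors *)

Section LebesgueMeasure.
Context {R : realType}.

Lemma measurable_coord d (i : 'I_d) :
  measurable_fun [set: 'rV[R]_d] (fun x : 'rV[R]_d => x ord0 i).
Proof.
have /measurable_fun_rVP : measurable_fun setT (@id 'rV[R]_d) by exact: measurable_id.
exact.
Qed.

Lemma ball_rVE d (x : 'rV[R]_d) (r : R) : 0 < r ->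
  ball x r = \bigcap_(i in [set: 'I_d]) ((fun y : 'rV[R]_d => y ord0 i) @^-1` ball (x ord0 i) r).
Proof.
move=> r0; apply/seteqP; split=> y.
  by move=> [_ xy] i _; exact: xy.
by move=> xy; split=> // i j; rewrite (ord1 i); exact: xy.
Qed.

Lemma measurable_rV_ball d (x : 'rV[R]_d) (r : R) : measurable (ball x r).
Proof.
have [r0|r0] := ltP 0 r; last first.
  rewrite (_ : ball x r = set0) //; apply/seteqP; split=> // y [].
  by rewrite ltNge r0.
rewrite ball_rVE //; apply: fin_bigcap_measurable => // i _.
rewrite -[X in measurable X]setTI; apply: measurable_coord => //.
exact: measurable_ball.
Qed.

(** The sigma-algebra is generated by the coordinates, so an open set is written as a countable
    union of cubes with rational centers and radii [1 / (m + 1)]. *)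
Lemma open_measurable_rV d (A : set 'rV[R]_d) : open A -> measurable A.
Proof.
move=> oA.
pose B (p : 'rV[rat]_d * nat) : set 'rV[R]_d :=
  ball (\row_i ratr (p.1 ord0 i) : 'rV[R]_d) p.2.+1%:R^-1.
pose F p := if `[< B p `<=` A >] then B p else set0.
have -> : A = \bigcup_p F p.
  apply/seteqP; split=> [x Ax|x [p _]]; last first.
    by rewrite /F; case: asboolP => // BA; exact: BA.
  have /nbhs_ballP[e /= e0 xeA] : nbhs x A by exact: open_nbhs_nbhs.
  have [m me] : exists m, m.+1%:R^-1 < e / 2.
    have e20 : 0 < e / 2 by rewrite divr_gt0.
    exists (Num.truncn (e / 2)^-1); rewrite -[ltRHS]invrK ltf_pV2 ?posrE ?invr_gt0//.
    exact: truncnS_gt.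
  set dl := m.+1%:R^-1 in me; have dl0 : 0 < dl by rewrite invr_gt0.
  have Q i : exists q : rat, ratr q \in `]x ord0 i - dl, x ord0 i + dl[.
    by have := @rat_in_itvoo _ (x ord0 i - dl) (x ord0 i + dl); apply; lra.
  have [q qP] := choice Q.
  have Bx : B (\row_i q i, m) x.
    split => // i j; rewrite (ord1 i) !mxE /ball /=.
    have := qP j; rewrite in_itv /= => /andP[? ?].
    by rewrite ltr_norml -/dl; apply/andP; split; lra.
  exists (\row_i q i, m) => //; rewrite /F; case: asboolP => // -[].
  move=> y By; apply: xeA; apply: (@le_ball _ _ _ (dl + dl)); first by lra.
  by apply: ball_triangle By; exact: ball_sym.
apply: countable_bigcupT_measurable => [|p]; first exact: countableP.
by rewrite /F; case: asboolP => // _; exact: measurable_rV_ball.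
Qed.

Lemma rV_cons0 d (p : R * 'rV[R]_d) : rV_cons p ord0 ord0 = p.1.
Proof. by have /(congr1 fst) := rV_consK p. Qed.

Lemma rV_consS d (p : R * 'rV[R]_d) (j : 'I_d) :
  rV_cons p ord0 (rshift 1 j) = p.2 ord0 j.
Proof. exact: (row_mxEr (p.1%:M : 'rV_1) p.2 ord0 j). Qed.

(** Balls of the sup norm are cubes, whose volume follows by splitting off one coordinate at a time.
    Only volumes of cubes are computed below; Euclidean balls enter through inclusions. *)
Lemma lebesgue_rV_ball d (x : 'rV[R]_d) (r : R) : 0 < r ->
  lebesgue_rV (ball x r) = ((r *+ 2) ^+ d)%:E.
Proof.
move=> r0; elim: d x => [|d IH] x.
  rewrite expr0 /= diracE mem_set // (_ : ball x r = setT) //.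
  by apply/seteqP; split=> // y _; split => // i [].
rewrite /= /lebesgue_rVS /pushforward.
have -> : @rV_cons R d @^-1` ball x r =
    ball (x ord0 ord0) r `*` ball (rsubmx (x : 'rV_(1 + d))) r.
  apply/seteqP; split=> -[a v] /=.
    move=> [_ xy]; split; [have := xy ord0 ord0|split=> // i j; have := xy i (rshift 1 j)].
      by rewrite rV_cons0.
    by rewrite (ord1 i) rV_consS !mxE.
  move=> [xa [_ xv]]; split => // i j; rewrite (ord1 i).
  case: (split_ordP (j : 'I_(1 + d))) => k ->.
    have -> : lshift d k = ord0 :> 'I_d.+1 by rewrite (ord1 k); exact: val_inj.
    by rewrite rV_cons0.
  by rewrite rV_consS; have := xv ord0 k; rewrite !mxE.
rewrite product_measure1E; [|exact: measurable_ball|exact: measurable_rV_ball].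
rewrite [X in (X * _)%E](_ : _ = (r *+ 2)%:E); last exact/lebesgue_measure_ball/ltW.
by rewrite [X in (_ * X)%E](_ : _ = ((r *+ 2) ^+ d)%:E) ?exprS; last exact: IH.
Qed.

End LebesgueMeasure.

(** * The Euclidean norm *)

Section Euclidean.
Context {R : realType} {d : nat}.
Implicit Types x y z : 'rV[R]_d.

Lemma dotrvC x y : dotrv x y = dotrv y x.
Proof. by apply: eq_bigr => i _; rewrite mulrC. Qed.

Lemma dotrvDl x y z : dotrv (x + y) z = dotrv x z + dotrv y z.
Proof. by rewrite /dotrv -big_split; apply: eq_bigr => i _; rewrite mxE mulrDl. Qed.

Lemma dotrvZl a x y : dotrv (a *: x) y = a * dotrv x y.
Proof. by rewrite /dotrv mulr_sumr; apply: eq_bigr => i _; rewrite mxE mulrA. Qed.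

Lemma dotrvNl x y : dotrv (- x) y = - dotrv x y.
Proof. by rewrite -scaleN1r dotrvZl mulN1r. Qed.

Lemma dotrv_ge0 x : 0 <= dotrv x x.
Proof. by apply: sumr_ge0 => i _; rewrite -expr2 sqr_ge0. Qed.

Lemma enorm_ge0 x : 0 <= enorm x. Proof. exact: sqrtr_ge0. Qed.

Lemma enorm_sqr x : enorm x ^+ 2 = dotrv x x.
Proof. by rewrite sqr_sqrtr // dotrv_ge0. Qed.

Lemma enormN x : enorm (- x) = enorm x.
Proof. by rewrite /enorm dotrvNl dotrvC dotrvNl opprK. Qed.

Lemma enormB x y : enorm (x - y) = enorm (y - x).
Proof. by rewrite -enormN opprB. Qed.

Lemma enormZ a x : enorm (a *: x) = `|a| * enorm x.
Proof.
by rewrite /enorm dotrvZl dotrvC dotrvZl mulrA -expr2 sqrtrM ?sqr_ge0 // sqrtr_sqr.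
Qed.

Lemma le_coord_enorm x i : `|x ord0 i| <= enorm x.
Proof.
rewrite -(@ler_pXn2r _ 2) ?nnegrE ?enorm_ge0 // enorm_sqr real_normK ?num_real //.
rewrite /dotrv (bigD1 i) //= -expr2 lerDl.
by apply: sumr_ge0 => j _; rewrite -expr2 sqr_ge0.
Qed.

Lemma enorm_eq0 x : (enorm x == 0) = (x == 0).
Proof.
apply/eqP/eqP => [x0|->]; last by rewrite -(scale0r 0) enormZ normr0 mul0r.
apply/rowP => i; rewrite mxE; apply/eqP.
by rewrite -normr_le0 -x0 le_coord_enorm.
Qed.

Lemma enorm_le_coord x (r : R) : 0 <= r -> (forall i, `|x ord0 i| <= r) ->
  enorm x <= d%:R * r.
Proof.
move=> r0 xr.
rewrite -(@ler_pXn2r _ 2) ?nnegrE ?enorm_ge0 ?mulr_ge0 // enorm_sqr.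
have : dotrv x x <= d%:R * r ^+ 2.
  apply: (@le_trans _ _ (\sum_(i < d) r ^+ 2)).
    apply: ler_sum => i _; rewrite -expr2 -[leLHS]real_normK ?num_real //.
    by rewrite ler_pXn2r ?nnegrE.
  by rewrite sumr_const card_ord mulr_natl.
move=> /le_trans; apply; rewrite exprMn ler_wpM2r ?sqr_ge0 //.
by rewrite -natrX ler_nat; case: (d) => // n; rewrite leq_pmulr.
Qed.

(** Cauchy-Schwarz: the squared norm of [|y| x - |x| y] is nonnegative and equals
    [2 |x| |y| (|x| |y| - x.y)]. *)
Lemma dotrv_le x y : dotrv x y <= enorm x * enorm y.
Proof.
have [/eqP|y0] := eqVneq (enorm y) 0.
  rewrite enorm_eq0 => /eqP ->; rewrite dotrvC -(scale0r 0) dotrvZl mul0r.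
  by rewrite mulr_ge0 ?enorm_ge0.
have {}y0 : 0 < enorm y by rewrite lt0r y0 enorm_ge0.
have := dotrv_ge0 (enorm y *: x - enorm x *: y).
rewrite dotrvDl !dotrvNl !dotrvZl !(dotrvC _ (_ - _)) !dotrvDl !dotrvNl !dotrvZl.
rewrite -!enorm_sqr (dotrvC y x) => h.
have [/eqP|x0] := eqVneq (enorm x) 0.
  rewrite enorm_eq0 => /eqP ->; rewrite -(scale0r 0) dotrvZl mul0r.
  by rewrite mulr_ge0 ?enorm_ge0.
have {}x0 : 0 < enorm x by rewrite lt0r x0 enorm_ge0.
have : 0 <= 2 * (enorm x * enorm y) * (enorm x * enorm y - dotrv x y).
  by apply: le_trans h _; rewrite le_eqVlt; apply/orP; left; apply/eqP; ring.
by rewrite pmulr_rge0 ?subr_ge0 // !mulr_gt0.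
Qed.

Lemma enormD x y : enorm (x + y) <= enorm x + enorm y.
Proof.
rewrite -(@ler_pXn2r _ 2) ?nnegrE ?addr_ge0 ?enorm_ge0 // enorm_sqr.
rewrite dotrvDl !(dotrvC _ (x + y)) !dotrvDl -!enorm_sqr (dotrvC y x).
by have := dotrv_le x y; nra.
Qed.

Lemma enorm_triangle z x y : enorm (x - y) <= enorm (x - z) + enorm (z - y).
Proof. by rewrite (_ : x - y = (x - z) + (z - y)) ?enormD // addrA subrK. Qed.

Lemma enorm_distl x y : `|enorm x - enorm y| <= enorm (x - y).
Proof.
rewrite ler_norml; apply/andP; split.
  by have := enormD (y - x) x; rewrite subrK enormB; lra.
by have := enormD (x - y) y; rewrite subrK; lra.
Qed.

Lemma subball_enorm x y (r : R) : ball x r y -> enorm (x - y) <= d%:R * r.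
Proof.
move=> [r0 xy]; apply: enorm_le_coord; first exact: ltW.
by move=> i; rewrite !mxE; apply: ltW; exact: xy.
Qed.

Lemma enorm_subball x y (r : R) : enorm (x - y) < r -> ball x r y.
Proof.
move=> xy; split=> [|i j]; first exact: le_lt_trans (enorm_ge0 _) xy.
by apply: le_lt_trans xy; have := le_coord_enorm (x - y) j; rewrite !mxE (ord1 i).
Qed.

Lemma nbhs_enormP x (A : set 'rV[R]_d) :
  nbhs x A <-> exists2 r, 0 < r & forall y, enorm (x - y) < r -> A y.
Proof.
split=> [/nbhs_ballP[e /= e0 xA]|[r r0 xA]].
  by exists e => // y /enorm_subball; exact: xA.
(* A sup-norm ball of radius [t] has Euclidean radius at most [d * t]. The divisor [d + 1] makes the
   inequality strict and stays positive for [d = 0]. *)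
apply/nbhs_ballP; exists (r / d.+1%:R); first by rewrite /= divr_gt0.
move=> y /subball_enorm xy; apply: xA; apply: le_lt_trans xy _.
rewrite mulrCA gtr_pMr // ltr_pdivrMr // mul1r ltr_nat //.
Qed.

Lemma measurable_fun_enorm d0 (T : measurableType d0) (f : T -> 'rV[R]_d) :
  measurable_fun setT f -> measurable_fun setT (fun t => enorm (f t)).
Proof.
move=> /measurable_fun_rVP mf.
have m1 : measurable_fun setT (fun t => dotrv (f t) (f t)).
  by apply: measurable_sum => i; apply: measurable_funM; exact: mf.
apply: eq_measurable_fun; last first.
  by apply: measurableT_comp m1; exact: (measurable_powR 2^-1).
by move=> t _ /=; rewrite powR12_sqrt // dotrv_ge0.
Qed.

Lemma measurable_fun_rVB d0 (T : measurableType d0) (f g : T -> 'rV[R]_d) :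
  measurable_fun setT f -> measurable_fun setT g ->
  measurable_fun setT (fun t => f t - g t).
Proof.
move=> /measurable_fun_rVP mf /measurable_fun_rVP mg; apply/measurable_fun_rVP => i.
rewrite (_ : (fun _ => _) = (fun t => f t ord0 i - g t ord0 i)); last first.
  by apply/funext => t; rewrite !mxE.
by apply: measurable_funB; [exact: mf|exact: mg].
Qed.

End Euclidean.

(** * The Gagliardo kernel *)

Section Kernel.
Context {R : realType} {d : nat}.
Local Notation mu := (@lebesgue_rV R d).

Definition gagliardo_kernel (s : R) (x y : 'rV[R]_d) : R :=
  (enorm (x - y) `^ (d%:R + 2 * s))^-1.
Local Notation K := gagliardo_kernel.

Lemma gagliardo_kernel_ge0 s x y : 0 <= K s x y.
Proof. by rewrite invr_ge0 powR_ge0. Qed.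

Lemma gagliardo_kernelC s x y : K s x y = K s y x.
Proof. by rewrite /K enormB. Qed.

Lemma measurable_gagliardo_kernel s d0 (T : measurableType d0) (f g : T -> 'rV[R]_d) :
  measurable_fun setT f -> measurable_fun setT g ->
  measurable_fun setT (fun t => K s (f t) (g t)).
Proof.
move=> mf mg; under eq_fun do rewrite /K -powRN.
apply: (measurableT_comp (measurable_powR (- (d%:R + 2 * s)))).
exact/measurable_fun_enorm/measurable_fun_rVB.
Qed.

Lemma dyadic_scale (t : R) : 1 <= t -> exists j : nat, 2 ^+ j <= t < 2 ^+ j.+1.
Proof.
move=> t1; have ex : exists j : nat, t < 2 ^+ j.+1.
  exists (Num.truncn t).
  have := @truncnS_gt _ t; move/lt_le_trans; apply.
  by rewrite -natrX ler_nat ltnW // ltn_expl.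
case: (ex_minnP ex) => j tj jmin; exists j; rewrite tj andbT.
case: j => [|j] in tj jmin *; first by rewrite expr0.
by rewrite leNgt; apply/negP => /jmin; rewrite ltnn.
Qed.

Lemma powRXn (x p : R) n : 0 <= x -> (x ^+ n) `^ p = (x `^ p) ^+ n.
Proof.
move=> x0; rewrite -(powR_mulrn n x0) -(powR_mulrn n (powR_ge0 x p)).
by rewrite -!powRrM mulrC.
Qed.

Lemma ltr_powR (b x y : R) : 1 < b -> x < y -> b `^ x < b `^ y.
Proof.
move=> b1 xy; have b0 : 0 < b by exact: lt_trans b1.
rewrite -(subrK x y) powRD ?(gt_eqF b0) ?implybT // ltr_pMl ?powR_gt0 //.
have : 1 `^ (y - x) < b `^ (y - x).
  by rewrite gt0_ltr_powR ?nnegrE ?subr_gt0 // ltW.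
by rewrite powR1.
Qed.

(** A cube of volume [3 a] about [x], deprived of [E] and of the concentric cube of volume [a],
    keeps measure at least [a]. On it [|x - y| <= C a^(1/d)], so the kernel is at least
    [c a^(-(d + 2s)/d)]; multiplying by [a] leaves the power [-2s/d]. *)
Lemma gagliardo_kernel_compl_ge (s : R) : (0 < d)%N -> 0 < s ->
  exists2 c : R, 0 < c & forall (E : set 'rV[R]_d) (a : R) x, measurable E ->
    0 < a -> (mu E <= a%:E)%E ->
    ((c * a `^ (- (2 * s / d%:R)))%:E <=
      \int[mu]_y (K s x y * \1_(~` E) y)%:E)%E.
Proof.
move=> d0 s0; set p := d%:R + 2 * s.
have dR : 0 < d%:R :> R by rewrite ltr0n.
have p0 : 0 < p by rewrite addr_gt0 ?mulr_gt0.
have ballE (x : 'rV[R]_d) (a : R) : 0 < a ->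
    0 < a `^ d%:R^-1 / 2 /\ mu (ball x (a `^ d%:R^-1 / 2)) = a%:E.
  move=> a0; have q0 : 0 < a `^ d%:R^-1 / 2 by rewrite divr_gt0 ?powR_gt0.
  split => //; rewrite lebesgue_rV_ball //.
  rewrite (_ : _ *+ 2 = a `^ d%:R^-1); last by rewrite mulr2n; field.
  by rewrite -powR_mulrn ?powR_ge0 // -powRrM mulVf ?gt_eqF // powRr1 // ltW.
exists ((d%:R / 2 * 3 `^ d%:R^-1) `^ (- p)).
  by rewrite powR_gt0 // mulr_gt0 ?powR_gt0 ?divr_gt0.
move=> E a x mE a0 Ea.
have a30 : 0 < 3 * a by rewrite mulr_gt0.
have [r0 rE] := ballE x _ a30; have [e0 eE] := ballE x _ a0.
set r := _ / 2 in r0 rE; set e := _ / 2 in e0 eE.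
have mr := measurable_rV_ball x r; have me := measurable_rV_ball x e.
(* The kernel vanishes on the diagonal, since [0 ^-1 = 0]: the small ball around
   [x] has to be removed. *)
pose S := ball x r `\` (ball x e `|` E).
have mS : measurable S by apply: measurableD => //; exact: measurableU.
have aS : (a%:E <= mu S)%E.
  have : (mu (ball x r) <= mu S + (mu (ball x e) + mu E))%E.
    apply: (@le_trans _ _ (mu (S `|` (ball x e `|` E)))).
      apply: le_measure; rewrite ?inE //; first by do !apply: measurableU.
      by move=> y ry; have [h|h] := EM ((ball x e `|` E) y); [right|left].
    apply: (le_trans (measureU2 _ _ _)) => //; first exact: measurableU.
    by apply: leeD => //; exact: measureU2.
  rewrite rE eE; move: (mu S) (measure_ge0 mu S) Ea (measure_ge0 mu E) => [b| |] //;
    last by rewrite leey.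
  case: (mu E) => [b'||] //= _; rewrite ?leey // -!EFinD !lee_fin; lra.
set P := d%:R * r.
have P0 : 0 < P by rewrite mulr_gt0.
apply: (@le_trans _ _ (\int[mu]_y (P `^ (- p) * \1_S y)%:E)%E); last first.
  apply: ge0_le_integral => //.
  - by move=> y _; rewrite lee_fin mulr_ge0 ?powR_ge0.
  - apply/measurable_EFinP; apply: measurable_funM => //; exact: measurable_indic.
  - apply/measurable_EFinP; apply: measurable_funM.
      exact: measurable_gagliardo_kernel.
    by apply: measurable_indic; exact: measurableC.
  move=> y _; rewrite lee_fin !indicE.
  case: (boolP (y \in S)); last by rewrite mulr0 mulr_ge0 // gagliardo_kernel_ge0.
  rewrite inE => -[xyr /not_orP[xye Ey]]; rewrite mem_set // !mulr1 powRN /K.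
  have h : e <= enorm (x - y).
    by rewrite leNgt; apply/negP => /enorm_subball.
  have exy : 0 < enorm (x - y) by exact: lt_le_trans h.
  rewrite lef_pV2 ?posrE ?powR_gt0 //; apply: ge0_ler_powR;
    rewrite ?nnegrE ?(ltW exy) ?(ltW P0) ?(ltW p0) //.
  exact: subball_enorm.
under eq_integral do rewrite EFinM.
rewrite ge0_integralZl_EFin ?powR_ge0 //; last first.
  by apply/measurable_EFinP; exact: measurable_indic.
rewrite integral_indic // setIT.
apply: (@le_trans _ _ ((P `^ (- p))%:E * a%:E)%E); last first.
  by apply: lee_wpmul2l => //; rewrite lee_fin powR_ge0.
rewrite -EFinM lee_fin le_eqVlt; apply/orP; left; apply/eqP.
set Q := d%:R / 2 * 3 `^ d%:R^-1.
have -> : P = Q * a `^ d%:R^-1 by rewrite /P /Q /r powRM // ?ltW //; ring.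
have Q0 : 0 <= Q by rewrite /Q mulr_ge0 ?powR_ge0 ?divr_ge0 ?ltW.
rewrite (powRM (- p) Q0 (powR_ge0 _ _)) -[RHS]mulrA; congr (_ * _).
have -> : (a `^ d%:R^-1) `^ (- p) * a = a `^ (d%:R^-1 * - p + 1).
  rewrite powRD; first by rewrite powRrM powRr1 // ltW.
  by rewrite (gt_eqF a0) implybT.
congr (_ `^ _); rewrite /p; field; exact: lt0r_neq0.
Qed.

(** Near [x] the integrand is [|x - y|^(1 - d - 2s)], integrable because [2s < 1]; far away it is
    [|x - y|^-(d + 2s)], integrable because [s > 0]. A dyadic majorant turns both parts into
    geometric series, with a bound uniform in [x]. *)
Lemma gagliardo_kernel_lipschitz_le (s : R) : (2 <= d)%N -> 0 < s -> s < 2^-1 ->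
  exists2 L : R, 0 < L & forall x,
    (\int[mu]_y (Num.min 1 (enorm (x - y)) * K s x y)%:E <= L%:E)%E.
Proof.
move=> d2 s0 s12; set p := d%:R + 2 * s.
have dR : 2 <= d%:R :> R by rewrite ler_nat.
pose tau : R := 2 `^ (p - 1); pose om : R := 2 `^ p.
have tau0 : 0 < tau by rewrite powR_gt0.
have om0 : 0 < om by rewrite powR_gt0.
have D0 : 0 < 2 ^+ d :> R by rewrite exprn_gt0.
(* The first term majorizes the integrand where [|x - y|] is about [2^-j], the second where it is
   about [2^j]. The supports are cubes large enough to contain these Euclidean annuli. *)
pose g (x : 'rV[R]_d) j (y : 'rV[R]_d) : R :=
  tau ^+ j.+1 * \1_(ball x (2 * (2 ^+ j)^-1)) y +
  (om ^+ j)^-1 * \1_(ball x (2 * 2 ^+ j)) y.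
have g0 x j y : 0 <= g x j y.
  by rewrite addr_ge0 // mulr_ge0 ?invr_ge0 ?exprn_ge0 // ltW.
have pointwise x y : exists j, Num.min 1 (enorm (x - y)) * K s x y <= g x j y.
  set t := enorm (x - y); have t0 : 0 <= t by exact: enorm_ge0.
  have [t00|tn0] := eqVneq t 0; first by exists 0%N; rewrite t00 min_r ?ler01 // mul0r.
  have {t0 tn0}t0 : 0 < t by rewrite lt0r tn0.
  rewrite /K -/t -/p.
  have [t1|t1] := ltP t 1.
    have [j /andP[jt tj]] : exists j : nat, 2 ^+ j <= t^-1 < 2 ^+ j.+1.
      by apply: dyadic_scale; rewrite invf_ge1 // ltW.
    have tj' : t <= (2 ^+ j)^-1 by rewrite -[leLHS]invrK lef_pV2 ?posrE ?invr_gt0 ?exprn_gt0.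
    exists j; rewrite /g [\1__ _]indicE mem_set; last first.
      apply: enorm_subball; apply: le_lt_trans tj' _.
      by rewrite ltr_pMl ?ltr1n // invr_gt0 exprn_gt0.
    rewrite mulr1 (le_trans (_ : _ <= tau ^+ j.+1)) //; last first.
      by rewrite lerDl mulr_ge0 // invr_ge0 exprn_ge0 // ltW.
        have -> : t * (t `^ p)^-1 = (t^-1) `^ (p - 1).
      rewrite -(powR_inv1 (ltW t0)) -powRrM -powRN -[X in X * _](powRr1 (ltW t0)) -powRD.
        by congr (_ `^ _); ring.
      by rewrite (gt_eqF t0) implybT.
    rewrite -powRXn //; apply: ge0_ler_powR; rewrite ?nnegrE ?invr_ge0 ?exprn_ge0 ?(ltW t0) //.
      by rewrite /p; lra.
    exact: ltW.
  have [j /andP[jt tj]] := dyadic_scale t1.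
  exists j; rewrite /g [X in _ <= _ + _ * X]indicE mem_set; last first.
    by apply: enorm_subball; rewrite -exprS.
  rewrite mulr1 (le_trans (_ : _ <= (om ^+ j)^-1)) //; last first.
    by rewrite lerDr mulr_ge0 // exprn_ge0 // ltW.
    rewrite mul1r lef_pV2 ?posrE ?exprn_gt0 ?powR_gt0 // -powRXn //.
  apply: ge0_ler_powR; rewrite ?nnegrE ?exprn_ge0 ?(ltW t0) //.
  by rewrite /p; lra.
(* In powers of two, [r1] is [2^(2s - 1)] and [r2] is [2^(-2s)]: both ratios are below 1 exactly for
   [0 < s < 1/2]. *)
pose r1 := tau / 2 ^+ d; pose r2 := 2 ^+ d / om.
have r10 : 0 < r1 by rewrite divr_gt0.
have r20 : 0 < r2 by rewrite divr_gt0.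
have r11 : r1 < 1.
  rewrite ltr_pdivrMr // mul1r -powR_mulrn // /tau ltr_powR ?ltr1n // /p; lra.
have r21 : r2 < 1.
  rewrite ltr_pdivrMr // mul1r -powR_mulrn // /om ltr_powR ?ltr1n // /p; lra.
pose A1 := tau * 4 ^+ d; pose A2 : R := 4 ^+ d.
have A10 : 0 < A1 by rewrite mulr_gt0 // exprn_gt0.
have A20 : 0 < A2 by rewrite exprn_gt0.
have mg x j : measurable_fun setT (fun y => (g x j y)%:E).
  apply/measurable_EFinP; apply: measurable_funD; apply: measurable_funM => //;
  by apply: measurable_indic; exact: measurable_rV_ball.
have intg x j : (\int[mu]_y (g x j y)%:E = (A1 * r1 ^+ j + A2 * r2 ^+ j)%:E)%E.
  have I (k e : R) : 0 <= k -> 0 < e ->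
      (\int[mu]_y (k * \1_(ball x e) y)%:E = (k * (e *+ 2) ^+ d)%:E)%E.
    move=> k0 e0; under eq_integral do rewrite EFinM.
    have mb := measurable_rV_ball x e.
    rewrite ge0_integralZl_EFin //; last first.
      by apply/measurable_EFinP; exact: measurable_indic.
    rewrite integral_indic // setIT [X in (_ * X)%E](_ : _ = ((e *+ 2) ^+ d)%:E) //.
    exact: lebesgue_rV_ball.
  under eq_integral do rewrite EFinD.
  have mb e := measurable_rV_ball x e.
  rewrite ge0_integralD //; last 4 first.
  - by move=> y _; rewrite lee_fin mulr_ge0 // exprn_ge0 // ltW.
  - by apply/measurable_EFinP; apply: measurable_funM => //; exact: measurable_indic.
  - by move=> y _; rewrite lee_fin mulr_ge0 // invr_ge0 exprn_ge0 // ltW.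
  - by apply/measurable_EFinP; apply: measurable_funM => //; exact: measurable_indic.
  rewrite !I ?invr_ge0 ?exprn_ge0 ?mulr_gt0 ?invr_gt0 ?exprn_gt0 ?ltW //.
  rewrite -EFinD; congr (_ %:E); congr (_ + _).
    rewrite (_ : 2 / 2 ^+ j *+ 2 = 4 * (2 ^+ j)^-1); last by rewrite mulr2n; ring.
    rewrite /A1 /r1 !exprMn !exprVn exprS -!exprM (mulnC j d).
    by ring.
  rewrite (_ : 2 * 2 ^+ j *+ 2 = 4 * (2 ^+ j)); last by rewrite mulr2n; ring.
  by rewrite /A2 /r2 !exprMn !exprVn -!exprM (mulnC j d); ring.
exists (A1 * (1 - r1)^-1 + A2 * (1 - r2)^-1).
  by rewrite addr_gt0 // mulr_gt0 ?invr_gt0 ?subr_gt0.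
move=> x.
apply: (@le_trans _ _ (\int[mu]_y \big[+%E/0%E]_(0 <= j <oo) (g x j y)%:E)%E).
  apply: ge0_le_integral => //.
  - move=> y _; rewrite lee_fin mulr_ge0 ?gagliardo_kernel_ge0 //.
    by rewrite le_min ler01 enorm_ge0.
  - apply/measurable_EFinP; apply: measurable_funM.
      apply: measurable_minr => //; apply: measurable_fun_enorm.
      exact: measurable_fun_rVB.
    exact: measurable_gagliardo_kernel.
  - apply: ge0_emeasurable_sum => // j y _ _; by rewrite lee_fin.
  move=> y _; have [j jy] := pointwise x y.
  apply: (@le_trans _ _ (\sum_(0 <= i < j.+1) (g x i y)%:E)%E); last first.
    by apply: nneseries_lim_ge => i _ _; rewrite lee_fin.
  rewrite big_nat_recr //= (le_trans (_ : _ <= (g x j y)%:E)%E) ?lee_fin //.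
  by rewrite leeDr // sume_ge0 // => i _; rewrite lee_fin.
rewrite integral_nneseries //; last by move=> j y _; rewrite lee_fin.
apply: lime_le.
  by apply: is_cvg_nneseries => j _ _; apply: integral_ge0 => y _; rewrite lee_fin.
apply: nearW => k; rewrite (eq_bigr _ (fun j _ => intg x j)) sumEFin lee_fin.
rewrite big_split /=; apply: lerD.
  by have := @geometric_le_lim _ k A1 r1 (ltW A10) r10; apply; rewrite gtr0_norm.
by have := @geometric_le_lim _ k A2 r2 (ltW A20) r20; apply; rewrite gtr0_norm.
Qed.

End Kernel.

(** * The Gagliardo seminorm *)

Section DoubleIntegral.
Context {R : realType} {d : nat}.
Local Notation mu := (@lebesgue_rV R d).
Local Notation X := 'rV[R]_d.
Implicit Types f g h e : X * X -> R.

Definition dint f : \bar R := (\int[mu]_x \int[mu]_y (f (x, y))%:E)%E.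

Lemma measurable_dint_inner f : measurable_fun setT f -> (forall p, 0 <= f p) ->
  measurable_fun setT (fun x => \int[mu]_y (f (x, y))%:E)%E.
Proof.
move=> mf f0.
apply: (@measurable_fun_fubini_tonelli_F _ _ X X R mu (EFin \o f)).
  exact/measurable_EFinP.
by move=> p; rewrite lee_fin.
Qed.

Lemma measurable_pair1 f x : measurable_fun setT f ->
  measurable_fun setT (fun y => (f (x, y))%:E).
Proof.
move=> mf; apply/measurable_EFinP; apply: measurableT_comp mf _.
exact: measurable_pair1.
Qed.

Lemma dintD f g : measurable_fun setT f -> measurable_fun setT g ->
  (forall p, 0 <= f p) -> (forall p, 0 <= g p) ->
  dint (fun p => f p + g p) = (dint f + dint g)%E.
Proof.
move=> mf mg f0 g0; rewrite /dint -ge0_integralD //.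
- apply: eq_integral => x _; rewrite -ge0_integralD //.
  + by move=> y _; rewrite lee_fin.
  + exact: measurable_pair1.
  + by move=> y _; rewrite lee_fin.
  + exact: measurable_pair1.
- by move=> x _; apply: integral_ge0 => y _; rewrite lee_fin.
- exact: measurable_dint_inner.
- by move=> x _; apply: integral_ge0 => y _; rewrite lee_fin.
- exact: measurable_dint_inner.
Qed.

Lemma le_dint f g : measurable_fun setT f -> measurable_fun setT g ->
  (forall p, 0 <= f p) -> (forall p, f p <= g p) -> (dint f <= dint g)%E.
Proof.
move=> mf mg f0 fg; have g0 p : 0 <= g p by exact: le_trans (fg p).
apply: ge0_le_integral => //.
- by move=> x _; apply: integral_ge0 => y _; rewrite lee_fin.
- exact: measurable_dint_inner.
- exact: measurable_dint_inner.
move=> x _; apply: ge0_le_integral => //.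
- by move=> y _; rewrite lee_fin.
- exact: measurable_pair1.
- exact: measurable_pair1.
- by move=> y _; rewrite lee_fin.
Qed.

Lemma dint_swap f : measurable_fun setT f -> (forall p, 0 <= f p) ->
  dint (fun p => f (p.2, p.1)) = dint f.
Proof.
move=> mf f0; rewrite /dint.
rewrite (@fubini_tonelli _ _ X X R mu mu (EFin \o f)) //.
exact/measurable_EFinP.
Qed.

(** Cross terms carry weights in both variables. Tonelli replaces the swapped copy of [e] by [e]
    itself, so that only a weight in the first variable has to be integrated. *)
Lemma le_dint_symm f g h e : measurable_fun setT f -> measurable_fun setT g ->
  measurable_fun setT h -> measurable_fun setT e ->
  (forall p, 0 <= f p) -> (forall p, 0 <= g p) ->
  (forall p, 0 <= h p) -> (forall p, 0 <= e p) ->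
  (forall p, f p + g p <= h p + (e p + e (p.2, p.1))) ->
  (dint f + dint g <= dint h + (dint e + dint e))%E.
Proof.
move=> mf mg mh me f0 g0 h0 e0 le_fghe.
have me' : measurable_fun setT (fun p : X * X => e (p.2, p.1)).
  by apply: (measurableT_comp me); exact: measurable_swap.
have mee := measurable_funD me me'.
have ee0 p : 0 <= e p + e (p.2, p.1) by rewrite addr_ge0.
have ee := etrans (dintD me me' e0 (fun p => e0 (p.2, p.1)))
  (congr1 (fun z => dint e + z)%E (dint_swap me e0)).
have hee := etrans (dintD mh mee h0 ee0) (congr1 (fun z => dint h + z)%E ee).
have le_congr (x y x' y' : \bar R) : x = x' -> y = y' -> (x <= y -> x' <= y')%E.
  by move=> -> ->.
apply: (le_congr _ _ _ _ (dintD mf mg f0 g0) hee).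
by apply: le_dint => //; [exact: measurable_funD|exact: measurable_funD|
  move=> p; rewrite addr_ge0].
Qed.

Lemma dint_weight_le (phi : X -> R) f (L : R) :
  measurable_fun setT phi -> (forall x, 0 <= phi x) ->
  measurable_fun setT f -> (forall p, 0 <= f p) -> 0 <= L ->
  (forall x, \int[mu]_y (f (x, y))%:E <= L%:E)%E ->
  (dint (fun p => phi p.1 * f p)%R <= L%:E * \int[mu]_x (phi x)%:E)%E.
Proof.
move=> mphi phi0 mf f0 L0 fL.
rewrite -ge0_integralZl_EFin //; last 2 first.
- by move=> x _; rewrite lee_fin.
- exact/measurable_EFinP.
apply: ge0_le_integral => //.
- by move=> x _; apply: integral_ge0 => y _; rewrite lee_fin mulr_ge0.
- apply: (@measurable_dint_inner (fun p => phi p.1 * f p)) => [|p]; last by rewrite mulr_ge0.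
  apply: measurable_funM => //; exact: measurableT_comp mphi measurable_fst.
- by apply: measurable_funeM; exact/measurable_EFinP.
move=> x _ /=; under eq_integral do rewrite EFinM.
rewrite ge0_integralZl_EFin //; last 2 first.
- by move=> y _; rewrite lee_fin.
- exact: measurable_pair1.
by rewrite muleC; apply: lee_wpmul2r => //; rewrite lee_fin.
Qed.

Lemma dint_weight_ge (phi : X -> R) f (L : R) :
  measurable_fun setT phi -> (forall x, 0 <= phi x) ->
  measurable_fun setT f -> (forall p, 0 <= f p) -> 0 <= L ->
  (forall x, L%:E <= \int[mu]_y (f (x, y))%:E)%E ->
  (L%:E * \int[mu]_x (phi x)%:E <= dint (fun p => phi p.1 * f p)%R)%E.
Proof.
move=> mphi phi0 mf f0 L0 fL.
rewrite -ge0_integralZl_EFin //; last 2 first.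
- by move=> x _; rewrite lee_fin.
- exact/measurable_EFinP.
apply: ge0_le_integral => //.
- by move=> x _; rewrite mule_ge0 ?lee_fin.
- by apply: measurable_funeM; exact/measurable_EFinP.
- apply: (@measurable_dint_inner (fun p => phi p.1 * f p)) => [|p]; last by rewrite mulr_ge0.
  apply: measurable_funM => //; exact: measurableT_comp mphi measurable_fst.
move=> x _ /=; under [leRHS]eq_integral do rewrite EFinM.
rewrite ge0_integralZl_EFin //; last 2 first.
- by move=> y _; rewrite lee_fin.
- exact: measurable_pair1.
by rewrite muleC; apply: lee_wpmul2l => //; rewrite lee_fin.
Qed.

End DoubleIntegral.

(** * Truncation and coercivity for the seminorm *)

Section Gagliardo.
Context {R : realType} {d : nat}.
Local Notation mu := (@lebesgue_rV R d).
Local Notation X := 'rV[R]_d.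
Local Notation K := gagliardo_kernel.
Variable s : R.
Implicit Types u w phi : X -> R.

Definition gagliardo_integrand u (p : X * X) : R :=
  `|u p.1 - u p.2| ^+ 2 * K s p.1 p.2.

Lemma gagliardo_sqE u : gagliardo_sq s u = dint (gagliardo_integrand u).
Proof. by []. Qed.

Lemma gagliardo_integrand_ge0 u p : 0 <= gagliardo_integrand u p.
Proof. by rewrite mulr_ge0 ?sqr_ge0 ?gagliardo_kernel_ge0. Qed.

Lemma measurable_kernel_pair : measurable_fun setT (fun p : X * X => K s p.1 p.2).
Proof. exact: measurable_gagliardo_kernel. Qed.

Lemma measurable_increment u : measurable_fun setT u ->
  measurable_fun setT (fun p : X * X => `|u p.1 - u p.2|).
Proof.
move=> mu_; apply: measurableT_comp => //; apply: measurable_funB.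
  exact: measurableT_comp mu_ measurable_fst.
exact: measurableT_comp mu_ measurable_snd.
Qed.

Lemma measurable_gagliardo_integrand u : measurable_fun setT u ->
  measurable_fun setT (gagliardo_integrand u).
Proof.
move=> mu_; apply: measurable_funM; last exact: measurable_kernel_pair.
by apply: measurable_funX; exact: measurable_increment.
Qed.

Lemma gagliardo_sq_ge0 u : (0 <= gagliardo_sq s u)%E.
Proof.
by apply: integral_ge0 => x _; apply: integral_ge0 => y _; rewrite lee_fin;
  exact: (gagliardo_integrand_ge0 u (x, y)).
Qed.

(** Here [a], [b] are values of a function and [c], [e] those of a barrier at the same two points.
    When both exceed the barrier, the squares differ by [-2 (c - e) ((a - c) - (b - e))], and the
    increment of the excess is at most the sum of the two excesses. Only [|c - e|] enters, so no
    cancellation in the barrier is used. *)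
Lemma truncation_increment (a b c e : R) :
  `|Num.min a c - Num.min b e| ^+ 2 +
  `|Num.max (a - c) 0 - Num.max (b - e) 0| ^+ 2 <=
  `|a - b| ^+ 2 +
  2 * `|c - e| * (Num.max (a - c) 0 + Num.max (b - e) 0).
Proof.
have n1 := ler_norm (c - e); have n2 := ler_norm (e - c).
rewrite distrC in n2; rewrite !real_normK ?num_real //.
have E1 (x y : R) : x <= y -> (Num.min x y = x) * (Num.max (x - y) 0 = 0).
  by move=> xy; rewrite min_l // max_r // subr_le0.
have E2 (x y : R) : y < x -> (Num.min x y = y) * (Num.max (x - y) 0 = x - y).
  by move=> xy; rewrite min_r ?ltW // max_l // subr_ge0 ltW.
move: `|c - e| n1 n2 => t n1 n2.
have [ac|ac] := lerP a c; have [be|be] := lerP b e.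
- by rewrite !(E1 _ _ ac) !(E1 _ _ be); lra.
(* With an excess at one point only, the cross term is controlled by [a - e <= c - e <= t]. *)
- rewrite !(E1 _ _ ac) !(E2 _ _ be).
  have : 0 <= (b - e) * (t - (a - e)) by apply: mulr_ge0; lra.
  by lra.
- rewrite !(E2 _ _ ac) !(E1 _ _ be).
  have : 0 <= (a - c) * (t - (b - c)) by apply: mulr_ge0; lra.
  by lra.
- rewrite !(E2 _ _ ac) !(E2 _ _ be).
  have : 0 <= (a - c) * (t + (c - e)) by apply: mulr_ge0; lra.
  have : 0 <= (b - e) * (t - (c - e)) by apply: mulr_ge0; lra.
  by lra.
Qed.

(** Integrate [truncation_increment] against the kernel. By symmetry the two excess terms contribute
    equally, each at most [2 L] times the integral of the excess, whence [4 L]. *)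
Lemma gagliardo_sq_truncation u w (L : R) :
  measurable_fun setT u -> measurable_fun setT w -> 0 <= L ->
  (forall x, \int[mu]_y (`|w x - w y| * K s x y)%:E <= L%:E)%E ->
  (gagliardo_sq s (fun x => Num.min (u x) (w x)) +
   gagliardo_sq s (fun x => Num.max (u x - w x) 0)%R <=
   gagliardo_sq s u + (4 * L)%:E * \int[mu]_x (Num.max (u x - w x)%R 0%R)%:E)%E.
Proof.
move=> mu_ mw L0 wL; set phi := fun x => Num.max (u x - w x) 0.
have phi0 x : 0 <= phi x by rewrite le_max lexx orbT.
have mphi : measurable_fun setT phi.
  by apply: measurable_maxr => //; exact: measurable_funB.
have mmin : measurable_fun setT (fun x => Num.min (u x) (w x)).
  exact: measurable_minr.
rewrite !gagliardo_sqE.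
pose F (p : X * X) := phi p.1 * (2 * (`|w p.1 - w p.2| * K s p.1 p.2)).
have wK0 p : 0 <= 2 * (`|w p.1 - w p.2| * K s p.1 p.2).
  by rewrite !mulr_ge0 ?gagliardo_kernel_ge0.
have mwK : measurable_fun setT (fun p : X * X => 2 * (`|w p.1 - w p.2| * K s p.1 p.2)).
  apply: measurable_funM => //; apply: measurable_funM.
    exact: measurable_increment.
  exact: measurable_kernel_pair.
have F0 p : 0 <= F p by rewrite mulr_ge0.
have mF : measurable_fun setT F.
  by apply: measurable_funM => //; exact: measurableT_comp mphi measurable_fst.
have FL : (dint F <= (2 * L)%:E * \int[mu]_x (phi x)%:E)%E.
  apply: dint_weight_le => //; first by rewrite mulr_ge0.
  move=> x /=; under eq_integral do rewrite EFinM.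
  rewrite ge0_integralZl_EFin //; last 2 first.
  - by move=> y _; rewrite lee_fin mulr_ge0 ?gagliardo_kernel_ge0.
  - apply: (@measurable_pair1 _ _ (fun p => `|w p.1 - w p.2| * K s p.1 p.2) x).
    apply: measurable_funM; [exact: measurable_increment|exact: measurable_kernel_pair].
  by rewrite EFinM; apply: lee_wpmul2l => //.
apply: (@le_trans _ _ (dint (gagliardo_integrand u) + (dint F + dint F))%E); last first.
  apply: leeD => //; rewrite (_ : 4 * L = 2 * L + 2 * L); last by ring.
  rewrite EFinD ge0_muleDl ?lee_fin ?mulr_ge0 //; exact: leeD.
have FE p : F p = phi p.1 * (2 * (`|w p.1 - w p.2| * K s p.1 p.2)) by [].
have phiE x : phi x = Num.max (u x - w x) 0 by [].
clearbody F phi.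
have i0 := gagliardo_integrand_ge0; have mi := measurable_gagliardo_integrand.
apply: (le_dint_symm (mi _ mmin) (mi _ mphi) (mi _ mu_) mF (i0 _) (i0 _) (i0 _) F0).
move=> [x y]; rewrite /gagliardo_integrand /= !FE /= !phiE.
rewrite (distrC (w y)) (gagliardo_kernelC _ y) -mulrDl.
have := truncation_increment (u x) (u y) (w x) (w y).
move/(ler_wpM2r (gagliardo_kernel_ge0 s x y)) => /le_trans; apply.
by rewrite le_eqVlt; apply/orP; left; apply/eqP; ring.
Qed.

(** A Faber-Krahn type inequality. Keeping only the pairs with [y] outside [E], where [phi y = 0],
    reduces the increment to [phi x] and leaves the kernel integrated over the complement of [E]. *)
Lemma gagliardo_sq_ge_support : (0 < d)%N -> 0 < s ->
  exists2 c : R, 0 < c & forall (E : set X) (a : R) phi,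
    measurable E -> 0 < a -> (mu E <= a%:E)%E ->
    measurable_fun setT phi -> (forall x, ~ E x -> phi x = 0) ->
    ((c * a `^ (- (2 * s / d%:R)))%:E * \int[mu]_x (phi x ^+ 2)%:E <=
     gagliardo_sq s phi)%E.
Proof.
move=> d0 s0; have [c c0 cP] := @gagliardo_kernel_compl_ge R d s d0 s0.
exists c => // E a phi mE a0 Ea mphi phi0.
rewrite gagliardo_sqE.
pose f (p : X * X) := K s p.1 p.2 * \1_(~` E) p.2.
have f0 p : 0 <= f p by rewrite mulr_ge0 ?gagliardo_kernel_ge0.
have mf : measurable_fun setT f.
  apply: measurable_funM; first exact: measurable_kernel_pair.
  have mC : measurable_fun setT (\1_(~` E) : X -> R).
    by apply: measurable_indic; exact: measurableC.
  exact: (measurableT_comp mC measurable_snd).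
have mphi2 : measurable_fun setT (fun x => phi x ^+ 2) by exact: measurable_funX.
apply: (@le_trans _ _ (dint (fun p => phi p.1 ^+ 2 * f p)%R)).
  apply: (@dint_weight_ge _ _ (fun x => phi x ^+ 2)) => //.
  - by move=> x; rewrite sqr_ge0.
  - by rewrite mulr_ge0 ?powR_ge0 // ltW.
  - by move=> x; exact: cP.
apply: le_dint.
- by apply: measurable_funM => //; exact: (measurableT_comp mphi2 measurable_fst).
- exact: measurable_gagliardo_integrand.
- by move=> p; rewrite mulr_ge0 ?sqr_ge0.
move=> [x y]; rewrite /f /gagliardo_integrand /= indicE.
have [yE|yE] := boolP (y \in ~` E); last first.
  by rewrite !mulr0 mulr_ge0 ?sqr_ge0 ?gagliardo_kernel_ge0.
move: yE; rewrite inE => /phi0 ->.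
by rewrite subr0 mulr1 real_normK // num_real.
Qed.

End Gagliardo.

(** * Comparison of a minimizer with its truncation *)

Section Minimizer.
Context {R : realType} {d : nat}.
Local Notation mu := (@lebesgue_rV R d).
Local Notation X := 'rV[R]_d.
Variables (s alpha : R) (Omega : set X) (f v : X -> R).
Hypotheses (mOmega : measurable Omega) (Omega_fin : (mu Omega < +oo)%E).
Hypotheses (alpha0 : 0 < alpha) (mf : measurable_fun setT f).
Hypothesis f2 : (\int[mu]_(x in Omega) (f x ^+ 2)%:E < +oo)%E.

(** The data is a general [f], so that the same estimates apply to the pair [f], [u] and to the pair
    [- f], [- u]. *)
Definition tracking_energy (z : X -> R) : \bar R :=
  (\int[mu]_(x in Omega) ((z x - f x) ^+ 2)%:E + alpha%:E * gagliardo_sq s z)%E.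

Hypothesis v_Hs0 : Hs0 s Omega v.
Hypothesis v_min : forall z, Hs0 s Omega z -> (tracking_energy v <= tracking_energy z)%E.

Let mv : measurable_fun setT v. Proof. by case: v_Hs0. Qed.
Let v0 x : ~ Omega x -> v x = 0. Proof. by case: v_Hs0 => _ h _; exact: h. Qed.
Let Gv : (gagliardo_sq s v < +oo)%E. Proof. by case: v_Hs0. Qed.

Lemma integral_support (g : X -> \bar R) : (forall x, ~ Omega x -> g x = 0%E) ->
  (\int[mu]_(x in Omega) g x = \int[mu]_x g x)%E.
Proof.
move=> g0; rewrite integral_mkcond; apply: eq_integral => x _; rewrite patchE.
by case: ifPn => //; rewrite notin_setE => /g0.
Qed.

Lemma gagliardo_sq0 : gagliardo_sq s ((fun=> 0) : X -> R) = 0%E.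
Proof.
rewrite gagliardo_sqE; apply: integral0_eq => x _; apply: integral0_eq => y _.
by rewrite /gagliardo_integrand subrr normr0 expr0n mul0r.
Qed.

Lemma Hs0_0 : Hs0 s Omega (fun=> 0).
Proof. by split; [exact: measurable_cst|by []|rewrite gagliardo_sq0]. Qed.

(** Compare with the zero function, whose energy is the integral of [f ^+ 2]. Finiteness is what
    later allows this integral to be cancelled. *)
Lemma tracking_fin : (\int[mu]_(x in Omega) ((v x - f x) ^+ 2)%:E < +oo)%E.
Proof.
have := v_min Hs0_0; rewrite /tracking_energy.
rewrite gagliardo_sq0 mule0 adde0 => h; apply: le_lt_trans f2; move: h.
under [X in (_ <= X)%E]eq_integral do rewrite sub0r sqrrN.
by apply: le_trans; rewrite leeDl // mule_ge0 ?gagliardo_sq_ge0 // lee_fin ltW.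
Qed.

Lemma minimizer_sqr_fin : (\int[mu]_(x in Omega) (v x ^+ 2)%:E < +oo)%E.
Proof.
have mfO := measurable_funTS mf : measurable_fun Omega f.
have mvO := measurable_funTS mv : measurable_fun Omega v.
have m1 : measurable_fun Omega (fun x => ((v x - f x) ^+ 2)%:E).
  by apply/measurable_EFinP; apply: measurable_funX; exact: measurable_funB.
have m2 : measurable_fun Omega (fun x => (f x ^+ 2)%:E).
  by apply/measurable_EFinP; apply: measurable_funX.
apply: (@le_lt_trans _ _ (\int[mu]_(x in Omega)
    (2%:E * (((v x - f x) ^+ 2)%:E + (f x ^+ 2)%:E)))%E).
  apply: ge0_le_integral => //.
  - by move=> x _; rewrite lee_fin sqr_ge0.
  - by apply/measurable_EFinP; apply: measurable_funX.
  - by apply: measurable_funeM; exact: emeasurable_funD.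
  - move=> x _; rewrite -EFinD -EFinM lee_fin.
    by have := sqr_ge0 (v x - 2 * f x); nra.
rewrite ge0_integralZl_EFin //; last 2 first.
- by move=> x _; rewrite adde_ge0 ?lee_fin ?sqr_ge0.
- exact: emeasurable_funD.
rewrite ge0_integralD //; last 2 first.
- by move=> x _; rewrite lee_fin sqr_ge0.
- by move=> x _; rewrite lee_fin sqr_ge0.
by rewrite lte_mul_pinfty // lte_add_pinfty // tracking_fin.
Qed.

Section Truncation.
Variables (w m : X -> R) (L : R).
Hypotheses (mw : measurable_fun setT w) (mm : measurable_fun setT m).
Hypotheses (L0 : 0 <= L).
Hypothesis wL : forall x,
  (\int[mu]_y (`|w x - w y| * gagliardo_kernel s x y)%:E <= L%:E)%E.
Hypothesis w_ext : forall x, ~ Omega x -> 0 <= w x.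
Hypothesis w_ge : forall x, -1 <= w x.

Let phi x := Num.max (v x - w x) 0.

Let phi_ge0 x : 0 <= phi x. Proof. by rewrite le_max lexx orbT. Qed.

Let mphi : measurable_fun setT phi.
Proof. by apply: measurable_maxr => //; exact: measurable_funB. Qed.

Let phi_ext x : ~ Omega x -> phi x = 0.
Proof. by move=> Ox; rewrite /phi v0 // max_r // sub0r oppr_le0 w_ext. Qed.

(** Since [w >= -1], the excess is at most the positive part of [v + 1], which is square integrable
    on [Omega]; outside [Omega] it vanishes because there [v = 0 <= w]. *)
Lemma excess_sqr_fin : (\int[mu]_x (phi x ^+ 2)%:E < +oo)%E.
Proof.
rewrite -(@integral_support (fun x => (phi x ^+ 2)%:E)); last first.
  by move=> x /phi_ext ->; rewrite expr0n.
have mvO := measurable_funTS mv : measurable_fun Omega v.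
have m1 : measurable_fun Omega (fun x => (v x ^+ 2)%:E).
  by apply/measurable_EFinP; apply: measurable_funX.
apply: (@le_lt_trans _ _ (\int[mu]_(x in Omega)
    (2%:E * ((v x ^+ 2)%:E + 1%:E)))%E).
  apply: ge0_le_integral => //.
  - by move=> x _; rewrite lee_fin sqr_ge0.
  - by apply/measurable_EFinP; apply: measurable_funX; exact: measurable_funTS.
  - by apply: measurable_funeM; exact: emeasurable_funD.
  - move=> x _; rewrite -EFinD -EFinM lee_fin /phi.
    have w1 := w_ge x; have [h|h] := lerP (v x - w x) 0.
      by rewrite expr0n mulr_ge0 // addr_ge0 // sqr_ge0.
    have := sqr_ge0 (v x - 1).
    have : 0 <= (1 + w x) * ((v x + 1) + (v x - w x)) by apply: mulr_ge0; lra.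
    by lra.
rewrite ge0_integralZl_EFin //; last 2 first.
- by move=> x _; rewrite adde_ge0 ?lee_fin ?sqr_ge0.
- exact: emeasurable_funD.
rewrite ge0_integralD //; last by move=> x _; rewrite lee_fin sqr_ge0.
rewrite integral_cst // mul1e.
by rewrite lte_mul_pinfty // lte_add_pinfty // minimizer_sqr_fin.
Qed.

Lemma excess_fin : (\int[mu]_x (phi x)%:E < +oo)%E.
Proof.
rewrite -(@integral_support (fun x => (phi x)%:E)); last by move=> x /phi_ext ->.
apply: (@le_lt_trans _ _ (\int[mu]_(x in Omega) ((phi x ^+ 2)%:E + 1%:E))%E).
  apply: ge0_le_integral => //.
  - by move=> x _; rewrite lee_fin.
  - by apply/measurable_EFinP; exact: measurable_funTS.
  - apply: emeasurable_funD => //; apply/measurable_EFinP.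
    by apply: measurable_funX; exact: measurable_funTS.
  - move=> x _; rewrite -EFinD lee_fin; have := sqr_ge0 (phi x - 2^-1); nra.
rewrite ge0_integralD //; last 2 first.
- by move=> x _; rewrite lee_fin sqr_ge0.
- apply/measurable_EFinP.
  by apply: measurable_funX; exact: measurable_funTS.
rewrite integral_cst // mul1e lte_add_pinfty //.
rewrite (@integral_support (fun x => (phi x ^+ 2)%:E)) ?excess_sqr_fin //.
by move=> x /phi_ext ->; rewrite expr0n.
Qed.

(** A supersolution up to the error [|m|]: the Euler-Lagrange equation reads [v x - f x + 2 alpha *
    int (v x - v y) K(x, y) dy = 0], and for [w] the nonlocal term is at least [- 2 alpha L]. *)
Hypothesis w_super : forall x, Omega x -> f x + 2 * alpha * L <= w x + `|m x|.

(** Comparing [v] with [min v w] itself, rather than differentiating the energy. *)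
Lemma excess_energy :
  (alpha%:E * gagliardo_sq s phi <= 2%:E * \int[mu]_x (phi x * `|m x|)%:E)%E.
Proof.
pose z x := Num.min (v x) (w x).
have mz : measurable_fun setT z by exact: measurable_minr.
have e2 := gagliardo_sq_truncation mv mw L0 wL.
rewrite -/phi -/z in e2.
have P_fin := excess_fin.
have G0 := gagliardo_sq_ge0 s v; have G1 := gagliardo_sq_ge0 s z.
have G2 := gagliardo_sq_ge0 s phi.
have P0 : (0 <= \int[mu]_x (phi x)%:E)%E.
  by apply: integral_ge0 => x _; rewrite lee_fin.
(* The truncation is an admissible competitor: [e2] controls its seminorm, the integral of [phi]
   being finite. *)
have z_Hs0 : Hs0 s Omega z.
  split; [exact: mz|by move=> x Ox; rewrite /z v0 // min_l // w_ext|].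
  apply: (@le_lt_trans _ _ (gagliardo_sq s z + gagliardo_sq s phi)%E).
    by rewrite leeDl.
  apply: le_lt_trans e2 _.
  by rewrite lte_add_pinfty // lte_mul_pinfty // lee_fin mulr_ge0.
have e1 := v_min z_Hs0; rewrite /tracking_energy in e1.
(* Where [v > w], one has [(v - f)^2 - (w - f)^2 = (v - w) (2 (w - f) + (v - w))], which [w_super]
   bounds below by [phi (4 alpha L - 2 |m|)]. The term in [4 alpha L] cancels the one produced by
   [e2]. *)
have e3 : (\int[mu]_(x in Omega) ((z x - f x) ^+ 2)%:E +
           (4 * alpha * L)%:E * \int[mu]_x (phi x)%:E <=
    \int[mu]_(x in Omega) ((v x - f x) ^+ 2)%:E +
           2%:E * \int[mu]_x (phi x * `|m x|)%:E)%E.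
  rewrite -(@integral_support (fun x => (phi x)%:E)); last by move=> x /phi_ext ->.
  rewrite -(@integral_support (fun x => (phi x * `|m x|)%:E)); last first.
    by move=> x /phi_ext ->; rewrite mul0r.
  have mO (g : X -> R) : measurable_fun setT g -> measurable_fun Omega (EFin \o g).
    by move=> mg; apply/measurable_EFinP; exact: measurable_funTS.
  have mphim : measurable_fun setT (fun x => phi x * `|m x|).
    by apply: measurable_funM => //; exact: measurableT_comp.
  have msq (g : X -> R) : measurable_fun setT g ->
      measurable_fun setT (fun x => (g x - f x) ^+ 2).
    by move=> mg; apply: measurable_funX; exact: measurable_funB.
  have aL0 : 0 <= 4 * alpha * L by rewrite !mulr_ge0 // ltW.
  rewrite -ge0_integralZl_EFin //; last 2 first.
  - by move=> x _; rewrite lee_fin.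
  - exact: mO.
  rewrite -ge0_integralZl_EFin //; last 2 first.
  - by move=> x _; rewrite lee_fin mulr_ge0.
  - exact: (mO _ mphim).
  rewrite -ge0_integralD //; last 4 first.
  - by move=> x _; rewrite lee_fin sqr_ge0.
  - exact: (mO _ (msq _ mz)).
  - by move=> x _; rewrite -EFinM lee_fin mulr_ge0.
  - by apply: measurable_funeM; exact: mO.
  rewrite -ge0_integralD //; last 4 first.
  - by move=> x _; rewrite lee_fin sqr_ge0.
  - exact: (mO _ (msq _ mv)).
  - by move=> x _; rewrite -EFinM lee_fin !mulr_ge0.
  - by apply: measurable_funeM; exact: (mO _ mphim).
  apply: ge0_le_integral => //.
  - by move=> x _; rewrite -EFinM adde_ge0 // lee_fin ?sqr_ge0 // mulr_ge0.
  - apply: emeasurable_funD; first exact: (mO _ (msq _ mz)).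
    by apply: measurable_funeM; exact: mO.
  - apply: emeasurable_funD; first exact: (mO _ (msq _ mv)).
    by apply: measurable_funeM; exact: (mO _ mphim).
  move=> x Ox; rewrite -!EFinM -!EFinD lee_fin /phi /z.
  have := w_super Ox; have := normr_ge0 (m x).
  have [M ->] : exists M : R, `|m x| = M by exists `|m x|.
  move=> M0 sup.
  have [h|h] := leP (v x) (w x).
    by rewrite max_r ?subr_le0 //; lra.
  rewrite max_l; last by rewrite subr_ge0 ltW.
  have : 0 <= (v x - w x) * (2 * (w x + M - f x - 2 * alpha * L) + (v x - w x)).
    by rewrite mulr_ge0 //; lra.
  by lra.
have i1 := tracking_fin.
have I0 : (0 <= \int[mu]_(x in Omega) ((v x - f x) ^+ 2)%:E)%E.
  by apply: integral_ge0 => x _; rewrite lee_fin sqr_ge0.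
have I1 : (0 <= \int[mu]_(x in Omega) ((z x - f x) ^+ 2)%:E)%E.
  by apply: integral_ge0 => x _; rewrite lee_fin sqr_ge0.
have Q0 : (0 <= \int[mu]_x (phi x * `|m x|)%:E)%E.
  by apply: integral_ge0 => x _; rewrite lee_fin mulr_ge0.
have Gvf := Gv.
(* All quantities are finite except possibly the integral on the right of the claim, and if that one
   is infinite the claim is trivial. What remains is real arithmetic between [e1], [e2] and [e3]. *)
move: (\int[mu]_x (phi x)%:E)%E P0 P_fin e2 e3 => [P| |] // P0 _.
move: (gagliardo_sq s v) Gvf G0 e1 => [gv| |] // _ G0.
move: (gagliardo_sq s z) (gagliardo_sq s phi) G1 G2 => [gz| |] // [gp| |] // G1 G2.
move: (\int[mu]_(x in Omega) ((v x - f x) ^+ 2)%:E)%E i1 I0 => [a| |] // _ I0.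
move: (\int[mu]_x (phi x * `|m x|)%:E)%E Q0 => [q| |] // Q0; last first.
  by move=> *; rewrite mulr_infty gtr0_sg // mul1e leey.
move: (\int[mu]_(x in Omega) ((z x - f x) ^+ 2)%:E)%E I1 => [b| |] // I1.
rewrite -!EFinM -!EFinD !lee_fin => e1 e2 e3.
have : alpha * (gz + gp) <= alpha * (gv + 4 * L * P) by rewrite ler_wpM2l // ltW.
by lra.
Qed.

End Truncation.

End Minimizer.

(** * Stampacchia iteration *)

Section Stampacchia.
Context {R : realType}.

(** Along the levels [k j = l (1 - 2^-j)] the gaps are halved, which costs a factor 4 per step; the
    superlinear power [1 + delta] compensates it, as [rho] satisfies [rho^delta = 1/4]. Hence
    [A (k j) <= V rho^j], and monotonicity passes to the level [l]. *)
Lemma stampacchia_iteration (A : R -> \bar R) (B V delta : R) :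
  0 < B -> 0 < V -> 0 < delta ->
  (forall k, 0 <= A k)%E ->
  (forall k h : R, 0 <= k -> k <= h -> (A h <= A k)%E) ->
  (forall k h a : R, 0 <= k -> k < h -> 0 < a -> (A k <= a%:E)%E ->
    (A h <= ((B / (h - k)) ^+ 2 * a `^ (1 + delta))%:E)%E) ->
  (A 0%R <= V%:E)%E ->
  A (2 * B * V `^ (delta / 2) * 2 `^ delta^-1) = 0%E.
Proof.
move=> B0 V0 delta0 A0 Amono Astep AV.
set l := _ * 2 `^ _.
have l0 : 0 < l by rewrite !mulr_gt0 ?powR_gt0.
pose rho : R := 4 `^ (- delta^-1).
have rho0 : 0 < rho by rewrite powR_gt0.
have rho1 : rho < 1.
  rewrite -[ltRHS](powRr0 4) ltr_powR ?ltr1n // oppr_lt0 invr_gt0 //.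
(* This equation determines [l]: with it the inductive step closes with equality. *)
have l2 : l ^+ 2 * rho = 4 * B ^+ 2 * V `^ delta.
  have W2 : (V `^ (delta / 2)) ^+ 2 = V `^ delta.
    rewrite -powR_mulrn ?powR_ge0 // -powRrM; congr (_ `^ _); lra.
  have -> : rho = ((2 `^ delta^-1) ^+ 2)^-1.
    by rewrite /rho powRN -powRXn //; congr ((_ `^ _)^-1); rewrite -natrX.
  have T0 : 0 < 2 `^ delta^-1 :> R by rewrite powR_gt0.
  move: (2 `^ delta^-1) T0 @l l0 => T T0 l l0.
  by rewrite -W2 /l; field; rewrite gt_eqF.
pose k j := l * (1 - (2 ^+ j)^-1).
have claim j : (A (k j) <= (V * rho ^+ j)%:E)%E.
  elim: j => [|j IH]; first by rewrite /k !expr0 invr1 subrr mulr0 mulr1.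
  have p2 : 0 < 2 ^+ j :> R by rewrite exprn_gt0.
  have kk : k j.+1 - k j = l / 2 ^+ j.+1.
    by rewrite /k exprS; field; rewrite gt_eqF.
  have kj0 : 0 <= k j.
    by rewrite mulr_ge0 ?(ltW l0) // subr_ge0 invf_le1 // exprn_ege1 // ler1n.
  have klt : k j < k j.+1 by rewrite -subr_gt0 kk divr_gt0 // exprn_gt0.
  have a0 : 0 < V * rho ^+ j by rewrite mulr_gt0 // exprn_gt0.
  apply: le_trans (Astep _ _ _ kj0 klt a0 IH) _; rewrite lee_fin kk.
  have -> : (V * rho ^+ j) `^ (1 + delta) = V * rho ^+ j * (V `^ delta * (4 ^+ j)^-1).
    rewrite powRD; last by rewrite (gt_eqF a0) implybT.
    rewrite powRr1 ?ltW //; congr (_ * _).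
    rewrite powRM ?exprn_ge0 ?(ltW V0) ?(ltW rho0) //; congr (_ * _).
    rewrite powRXn ?ltW // -exprVn; congr (_ ^+ _).
    by rewrite /rho -powRrM mulNr mulVf ?(gt_eqF delta0) // powR_inv1.
  have -> : 4 ^+ j = (2 ^+ j) ^+ 2 :> R by rewrite -exprM mulnC exprM; congr (_ ^+ _); ring.
  rewrite le_eqVlt; apply/orP; left; apply/eqP.
  have -> : V `^ delta = l ^+ 2 * rho / (4 * B ^+ 2).
    by rewrite l2; field; rewrite gt_eqF.
  rewrite !exprS; field; rewrite !gt_eqF //.
apply/eqP; rewrite eq_le A0 andbT.
apply/lee_addgt0Pr => e e0; rewrite add0e.
have [j je] : exists j, V * rho ^+ j < e.
  have : geometric V rho @ \oo --> 0 by apply: cvg_geometric; rewrite gtr0_norm.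
  move=> /cvgr_lt/(_ _ e0)[j _ jP]; exists j; exact: (jP j (leqnn j)).
apply: le_trans (_ : A (k j) <= _)%E; last first.
  by apply: le_trans (claim j) _; rewrite lee_fin ltW.
apply: Amono.
  by rewrite mulr_ge0 ?(ltW l0) // subr_ge0 invf_le1 ?exprn_gt0 // exprn_ege1 // ler1n.
by rewrite /k ler_piMr ?(ltW l0) // gerBl invr_ge0 exprn_ge0.
Qed.

(** Each term covers one side of the threshold [lam]: the first handles [m <= lam], the second
    [m > lam], where [m^(2 - q) <= lam^(2 - q)] because [2 - q <= 0]. *)
Lemma sqr_le_powR (lam m q : R) : 0 < lam -> 2 <= q -> 0 <= m ->
  m ^+ 2 <= lam ^+ 2 + lam `^ (2 - q) * m `^ q.
Proof.
move=> lam0 q2 m0; have [ml|ml] := lerP m lam.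
  rewrite -[leLHS]addr0 lerD ?mulr_ge0 ?powR_ge0 //.
  by rewrite ler_pXn2r // nnegrE ltW.
have {}m0 : 0 < m by exact: lt_trans ml.
rewrite -[leLHS]add0r lerD ?sqr_ge0 //.
have -> : m ^+ 2 = m `^ (2 - q) * m `^ q.
  rewrite -powRD ?subrK ?powR_mulrn ?(ltW m0) //.
  by rewrite (gt_eqF m0) implybT.
rewrite ler_wpM2r ?powR_ge0 // -(opprB q 2) !powRN lef_pV2 ?posrE ?powR_gt0 //.
by apply: ge0_ler_powR; rewrite ?nnegrE ?subr_ge0 ?(ltW lam0) ?(ltW m0) ?(ltW ml).
Qed.

End Stampacchia.

(** * The noise on sets of small measure *)

Section LevelSets.
Context {R : realType} {d : nat}.
Local Notation mu := (@lebesgue_rV R d).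
Local Notation X := 'rV[R]_d.

(** Hoelder's inequality up to the factor 2: splitting [|m|] at the height [lam = M a^(-1/q)]
    balances the two contributions, each bounded by [M^2 a^(1 - 2/q)]. *)
Lemma integral_sqr_on_le (E : set X) (m : X -> R) (a M q : R) :
  measurable E -> measurable_fun setT m -> 0 < a -> 0 < M -> 2 <= q ->
  (mu E <= a%:E)%E -> (\int[mu]_x (`|m x| `^ q)%:E <= (M `^ q)%:E)%E ->
  (\int[mu]_x (`|m x| ^+ 2 * \1_E x)%:E <= (2 * M ^+ 2 * a `^ (1 - 2 / q))%:E)%E.
Proof.
move=> mE mm a0 M0 q2 Ea mM.
have q0 : 0 < q by exact: lt_le_trans q2.
pose lam := M * a `^ (- q^-1).
have lam0 : 0 < lam by rewrite mulr_gt0 ?powR_gt0.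
have mI : measurable_fun setT (\1_E : X -> R) by exact: measurable_indic.
have mabs : measurable_fun setT (fun x => `|m x|) by exact: measurableT_comp.
have mpow : measurable_fun setT (fun x => `|m x| `^ q).
  exact: (measurableT_comp (measurable_powR q) mabs).
apply: (@le_trans _ _ (\int[mu]_x ((lam ^+ 2)%:E * (\1_E x)%:E +
    (lam `^ (2 - q))%:E * (`|m x| `^ q)%:E))%E).
  apply: ge0_le_integral => //.
  - by apply/measurable_EFinP; apply: measurable_funM => //; exact: measurable_funX.
  - by apply: emeasurable_funD; apply: measurable_funeM; exact/measurable_EFinP.
  move=> x _; rewrite -!EFinM -EFinD lee_fin indicE.
  case: (x \in E); last by rewrite !mulr0 add0r mulr_ge0 ?powR_ge0.
  by rewrite !mulr1 sqr_le_powR.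
rewrite ge0_integralD //; last 4 first.
- by move=> x _; rewrite -EFinM lee_fin mulr_ge0 ?sqr_ge0.
- by apply: measurable_funeM; exact/measurable_EFinP.
- by move=> x _; rewrite -EFinM lee_fin mulr_ge0 ?powR_ge0.
- by apply: measurable_funeM; exact/measurable_EFinP.
rewrite ge0_integralZl_EFin ?sqr_ge0 //; last exact/measurable_EFinP.
rewrite ge0_integralZl_EFin ?powR_ge0 //; last exact/measurable_EFinP.
rewrite integral_indic // setIT.
apply: (@le_trans _ _ ((lam ^+ 2)%:E * a%:E + (lam `^ (2 - q))%:E * (M `^ q)%:E)%E).
  by apply: leeD; apply: lee_wpmul2l; rewrite ?lee_fin ?sqr_ge0 ?powR_ge0.
rewrite -!EFinM -EFinD lee_fin le_eqVlt; apply/orP; left; apply/eqP.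
have aP (y z : R) : a `^ y * a `^ z = a `^ (y + z).
  by rewrite powRD // (gt_eqF a0) implybT.
have e1 : lam ^+ 2 * a = M ^+ 2 * a `^ (1 - 2 / q).
  rewrite /lam exprMn -powRXn ?ltW // -mulrA; congr (_ * _).
  rewrite -powR_mulrn ?ltW // -powRrM -[X in _ * X = _](powRr1 (ltW a0)) aP.
  by congr (_ `^ _); field; rewrite gt_eqF.
have e2 : lam `^ (2 - q) * M `^ q = M ^+ 2 * a `^ (1 - 2 / q).
  rewrite /lam (powRM _ (ltW M0) (powR_ge0 _ _)) mulrAC -powRD; last first.
    by rewrite (gt_eqF M0) implybT.
  rewrite subrK powR_mulrn ?ltW // -powRrM; congr (_ * _ `^ _).
  by field; rewrite gt_eqF.
by rewrite e1 e2; ring.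
Qed.

End LevelSets.

(** * Upper bound by a barrier through its excess sets *)

Section SupBound.
Context {R : realType} {d : nat}.
Local Notation mu := (@lebesgue_rV R d).
Local Notation X := 'rV[R]_d.
Variables (s alpha : R) (Omega : set X) (f v : X -> R).
Hypotheses (mOmega : measurable Omega) (Omega_fin : (mu Omega < +oo)%E).
Hypotheses (alpha0 : 0 < alpha) (mf : measurable_fun setT f).
Hypothesis f2 : (\int[mu]_(x in Omega) (f x ^+ 2)%:E < +oo)%E.
Hypothesis v_Hs0 : Hs0 s Omega v.
Hypothesis v_min : forall z, Hs0 s Omega z ->
  (tracking_energy s alpha Omega f v <= tracking_energy s alpha Omega f z)%E.
Variables (w m : X -> R) (L : R).
Hypotheses (mw : measurable_fun setT w) (mm : measurable_fun setT m).
Hypotheses (L0 : 0 <= L).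
Hypothesis wL : forall x,
  (\int[mu]_y (`|w x - w y| * gagliardo_kernel s x y)%:E <= L%:E)%E.
Hypothesis w_ext : forall x, ~ Omega x -> 0 <= w x.
Hypothesis w_ge : forall x, -1 <= w x.
Hypothesis w_super : forall x, Omega x -> f x + 2 * alpha * L <= w x + `|m x|.

Variables (c q N V : R).
Hypothesis c0 : 0 < c.
Hypothesis support_bound : forall (E : set X) (a : R) (phi : X -> R),
    measurable E -> 0 < a -> (mu E <= a%:E)%E ->
    measurable_fun setT phi -> (forall x, ~ E x -> phi x = 0) ->
    ((c * a `^ (- (2 * s / d%:R)))%:E * \int[mu]_x (phi x ^+ 2)%:E <=
     gagliardo_sq s phi)%E.
Hypotheses (q2 : 2 <= q) (N0 : 0 < N).
Hypothesis mN : (\int[mu]_x (`|m x| `^ q)%:E <= ((alpha * N) `^ q)%:E)%E.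
Hypotheses (V0 : 0 < V) (OmegaV : (mu Omega <= V%:E)%E).

Let mv : measurable_fun setT v. Proof. by case: v_Hs0. Qed.
Let v0 x : ~ Omega x -> v x = 0. Proof. by case: v_Hs0 => _ h _; exact: h. Qed.

Definition excess_set (k : R) : set X := [set x | w x + k < v x].

Lemma measurable_excess_set k : measurable (excess_set k).
Proof.
rewrite /excess_set -[X in measurable X]setTI.
have h : measurable_fun setT (fun x => w x + k < v x).
  by apply: measurable_fun_ltr => //; exact: measurable_funD.
rewrite (_ : [set x | w x + k < v x] = (fun x => w x + k < v x) @^-1` [set true]).
  exact: h.
by apply/seteqP; split=> x.
Qed.

(** Apply [excess_energy] to the barrier [w + k], absorb half of the coercive term by Young's
    inequality, and pass to the higher level by Chebyshev. The exponent adds [2 (2s/d)], from the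
    square of the coercivity constant, to [1 - 2/q], from the noise. *)
Lemma excess_set_step (k h a : R) : 0 <= k -> k < h -> 0 < a ->
  (mu (excess_set k) <= a%:E)%E ->
  (mu (excess_set h) <=
   ((3 * N / c / (h - k)) ^+ 2 * a `^ (1 + (4 * s / d%:R - 2 / q)))%:E)%E.
Proof.
move=> k0 kh a0 Ea; set E := excess_set k; pose wk x := w x + k.
pose phi x := Num.max (v x - wk x) 0.
have mE : measurable E by exact: measurable_excess_set.
have mwk : measurable_fun setT wk by exact: measurable_funD.
have mphi : measurable_fun setT phi.
  by apply: measurable_maxr => //; exact: measurable_funB.
have wkL x : (\int[mu]_y (`|wk x - wk y| * gagliardo_kernel s x y)%:E <= L%:E)%E.
  by rewrite /wk; under eq_integral do rewrite opprD addrACA subrr addr0; exact: wL.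
have wk_ext x : ~ Omega x -> 0 <= wk x by move=> Ox; rewrite addr_ge0 // w_ext.
have wk_ge x : -1 <= wk x by have := w_ge x; rewrite /wk; lra.
have wk_super x : Omega x -> f x + 2 * alpha * L <= wk x + `|m x|.
  by move=> /w_super; rewrite /wk; lra.
have en := excess_energy mOmega Omega_fin alpha0 mf f2 v_Hs0 v_min mwk mm L0
  wkL wk_ext wk_ge wk_super.
have S_fin := excess_sqr_fin mOmega Omega_fin alpha0 mf f2 v_Hs0 v_min mwk wk_ext wk_ge.
rewrite -/phi in en S_fin.
have phi0 x : 0 <= phi x by rewrite le_max lexx orbT.
have phiE x : ~ E x -> phi x = 0.
  by move=> /negP; rewrite -leNgt => h'; rewrite /phi max_r // subr_le0.
have fk := support_bound mE a0 Ea mphi phiE.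
(* Half of the coercivity constant: the left side is at least [2 kap] times the integral of [phi^2],
   of which Young's inequality consumes one [kap]. *)
pose kap := alpha * (c * a `^ (- (2 * s / d%:R))) / 2.
have kap0 : 0 < kap by rewrite /kap divr_gt0 // !mulr_gt0 // powR_gt0.
have mphi2 : measurable_fun setT (fun x => phi x ^+ 2) by exact: measurable_funX.
have mabs : measurable_fun setT (fun x => `|m x|) by exact: measurableT_comp.
have mI : measurable_fun setT (\1_E : X -> R) by exact: measurable_indic.
have mm2 : measurable_fun setT (fun x => `|m x| ^+ 2 * \1_E x).
  by apply: measurable_funM => //; exact: measurable_funX.
have young : (2%:E * \int[mu]_x (phi x * `|m x|)%:E <=
    kap%:E * \int[mu]_x (phi x ^+ 2)%:E +
    (kap^-1)%:E * \int[mu]_x (`|m x| ^+ 2 * \1_E x)%:E)%E.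
  have mphim : measurable_fun setT (fun x => phi x * `|m x|) by exact: measurable_funM.
  rewrite -!ge0_integralZl_EFin ?invr_ge0 ?(ltW kap0) //;
    try first [exact/measurable_EFinP | by move=> x _; rewrite lee_fin ?mulr_ge0 ?sqr_ge0].
  rewrite -ge0_integralD //; last 4 first.
  - by move=> x _; rewrite -EFinM lee_fin mulr_ge0 ?sqr_ge0 // ltW.
  - by apply: measurable_funeM; exact/measurable_EFinP.
  - by move=> x _; rewrite -EFinM lee_fin !mulr_ge0 ?sqr_ge0 ?invr_ge0 // ltW.
  - by apply: measurable_funeM; exact/measurable_EFinP.
  apply: ge0_le_integral => //.
  - by move=> x _; rewrite -EFinM lee_fin !mulr_ge0.
  - by apply: measurable_funeM; exact/measurable_EFinP.
  - by apply: emeasurable_funD; apply: measurable_funeM; exact/measurable_EFinP.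
  move=> x _; rewrite -!EFinM -EFinD lee_fin indicE.
  have [xE|xE] := boolP (x \in E); last first.
    by rewrite notin_setE in xE; rewrite phiE // expr0n /= !mulr0 mul0r mulr0 addr0.
  rewrite mulr1.
  have := mulr_ge0 (ltW kap0) (sqr_ge0 (phi x - `|m x| / kap)).
  rewrite (_ : kap * _ = kap * phi x ^+ 2 + kap^-1 * `|m x| ^+ 2 - 2 * (phi x * `|m x|)).
    by rewrite subr_ge0.
  by field; rewrite gt_eqF.
have m2 := integral_sqr_on_le mE mm a0 (mulr_gt0 alpha0 N0) q2 Ea mN.
have S0 : (0 <= \int[mu]_x (phi x ^+ 2)%:E)%E.
  by apply: integral_ge0 => x _; rewrite lee_fin sqr_ge0.
have cheb : (((h - k) ^+ 2)%:E * mu (excess_set h) <= \int[mu]_x (phi x ^+ 2)%:E)%E.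
  have mEh := measurable_excess_set h.
  rewrite -[X in (_ * mu X)%E]setIT -integral_indic //.
  rewrite -ge0_integralZl_EFin ?sqr_ge0 //; last first.
    by apply/measurable_EFinP; exact: measurable_indic.
  apply: ge0_le_integral => //.
  - by move=> x _; rewrite -EFinM lee_fin mulr_ge0 ?sqr_ge0.
  - by apply: measurable_funeM; apply/measurable_EFinP; exact: measurable_indic.
  - exact/measurable_EFinP.
  move=> x _; rewrite -EFinM lee_fin indicE.
  have [|_] := boolP (x \in excess_set h); last by rewrite mulr0 sqr_ge0.
  rewrite inE /excess_set /= => xh; rewrite mulr1 /phi /wk max_l; last by lra.
  by rewrite ler_pXn2r ?nnegrE //; lra.
have fk' : (alpha%:E * ((c * a `^ (- (2 * s / d%:R)))%:E *
    \int[mu]_x (phi x ^+ 2)%:E) <= alpha%:E * gagliardo_sq s phi)%E.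
  by apply: lee_wpmul2l => //; rewrite lee_fin ltW.
have := le_trans fk' (le_trans en young).
move: (\int[mu]_x (`|m x| ^+ 2 * \1_E x)%:E)%E m2 => T m2.
move: (\int[mu]_x (phi x ^+ 2)%:E)%E S_fin S0 cheb => [S| |] // _ S0 cheb.
have {m2}m2 : ((kap^-1)%:E * T <= (kap^-1)%:E *
    (2 * (alpha * N) ^+ 2 * a `^ (1 - 2 / q))%:E)%E.
  by apply: lee_wpmul2l => //; rewrite lee_fin invr_ge0 ltW.
move=> h1; have := le_trans h1 (leeD2l (kap%:E * S%:E)%E m2).
rewrite -!EFinM -EFinD lee_fin.
have -> : alpha * (c * a `^ (- (2 * s / d%:R)) * S) = 2 * kap * S by rewrite /kap; field.
move=> h2; have {h2}h2 : S <= kap^-1 ^+ 2 * (2 * (alpha * N) ^+ 2 * a `^ (1 - 2 / q)).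
  rewrite expr2 -mulrA -ler_pdivrMl ?invr_gt0 // invrK; lra.
have hk0 : 0 < (h - k) ^+ 2 by rewrite exprn_gt0 // subr_gt0.
have {cheb h2} := le_trans cheb (lee_tofin h2).
rewrite muleC -lee_pdivlMr // -EFinM => /le_trans; apply; rewrite lee_fin.
have aP (y z : R) : a `^ y * a `^ z = a `^ (y + z).
  by rewrite powRD // (gt_eqF a0) implybT.
have -> : 1 + (4 * s / d%:R - 2 / q) = (2 * s / d%:R) + (2 * s / d%:R) + (1 - 2 / q) by lra.
rewrite -(aP (2 * s / d%:R + 2 * s / d%:R)) -(aP (2 * s / d%:R)) /kap powRN.
have A0 : 0 < a `^ (2 * s / d%:R) by rewrite powR_gt0.
move: (a `^ _) A0 => A A0; have : 0 <= a `^ (1 - 2 / q) by exact: powR_ge0.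
move: (a `^ _) => A' A'0.
(* The constant obtained is 8; it is rounded up to [9 = 3^2] to make the bound a perfect square. *)
have -> : ((alpha * (c / A) / 2)^-1 ^+ 2 * (2 * (alpha * N) ^+ 2 * A') / (h - k) ^+ 2) =
    8 / 9 * ((3 * N / c / (h - k)) ^+ 2 * (A * A * A')).
  by field; rewrite !gt_eqF // subr_gt0.
rewrite ler_piMl //; last by lra.
by apply: mulr_ge0; rewrite ?sqr_ge0 // !mulr_ge0 // ltW.
Qed.

(** The condition [q > d/(2s)] says exactly that [delta > 0]. The iteration starts from [V], since
    at level 0 the excess set lies in [Omega]; its final level is linear in [N] because
    [B = 3 N / c] is. *)
Lemma excess_set_null : (0 < d)%N -> 0 < s -> d%:R / (2 * s) < q ->
  let delta := 4 * s / d%:R - 2 / q in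
  mu (excess_set (6 / c * V `^ (delta / 2) * 2 `^ delta^-1 * N)) = 0%E.
Proof.
move=> d0 s0 qd delta.
have dR : 0 < d%:R :> R by rewrite ltr0n.
have q0 : 0 < q by exact: lt_le_trans q2.
have delta0 : 0 < delta.
  rewrite /delta subr_gt0 ltr_pdivrMr // mulrAC ltr_pdivlMr //.
  by move: qd; rewrite ltr_pdivrMr ?mulr_gt0 //; lra.
have := @stampacchia_iteration R (fun k => mu (excess_set k)) (3 * N / c) V delta.
set l := 2 * _ * _ * _; have -> : l = 6 / c * V `^ (delta / 2) * 2 `^ delta^-1 * N.
  by rewrite /l; field; rewrite gt_eqF.
apply => //.
- by rewrite divr_gt0 // mulr_gt0.
- move=> k h _ kh; apply: le_measure; rewrite ?inE; [exact: measurable_excess_set..|].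
  by move=> x; rewrite /excess_set /=; lra.
- by move=> k h a; exact: excess_set_step.
apply: le_trans OmegaV; apply: le_measure; rewrite ?inE //.
  exact: measurable_excess_set.
move=> x; rewrite /excess_set /= addr0 => wv; apply: contrapT => Ox.
by move: wv; rewrite v0 // ltNge w_ext.
Qed.

End SupBound.

(** * Pointwise bounds on the minimizer *)

Section Norms.
Context {R : realType} {d : nat}.
Local Notation mu := (@lebesgue_rV R d).
Local Notation X := 'rV[R]_d.

Lemma integral_powR_le (q M : R) (n : X -> R) : 0 < q ->
  (Lp_norm q%:E n <= M%:E)%E -> (\int[mu]_x (`|n x| `^ q)%:E <= (M `^ q)%:E)%E.
Proof.
move=> q0 nM; have := @poweR_Lnorm _ _ _ mu (EFin \o n) q (lt0r_neq0 q0).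
have -> : (\int[mu]_x (`|(EFin \o n) x| `^ q) = \int[mu]_x (`|n x| `^ q)%:E)%E.
  by apply: eq_integral => x _; rewrite -poweR_EFin.
move=> <-; move: nM; rewrite /Lp_norm.
have := Lnorm_ge0 mu q%:E (EFin \o n).
case: ('N[mu]_q%:E[EFin \o n])%E => [r| |] //; rewrite !lee_fin => r0 rM.
apply: ge0_ler_powR; rewrite ?nnegrE ?(ltW q0) //; exact: le_trans rM.
Qed.

Lemma measurable_Lp_dom (p : \bar R) (Omega : set X) (n : X -> R) :
  Lp_dom p Omega n -> measurable_fun setT n.
Proof. by case=> /sub_Lfun_mfun; rewrite inE. Qed.

Lemma bounded_measure_fin (Omega : set X) : measurable Omega -> bounded_set Omega ->
  exists2 V : R, 0 < V & (mu Omega <= V%:E)%E.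
Proof.
move=> mO /ex_strict_bound_gt0[M M0 OM].
exists ((M *+ 2) ^+ d); first by rewrite exprn_gt0 // pmulrn_lgt0.
apply: (@le_trans _ _ (mu (ball (0 : X) M))).
  apply: le_measure; rewrite ?inE //; first exact: measurable_rV_ball.
  by move=> x /OM /=; rewrite -ball_normE /= sub0r normrN.
by rewrite le_eqVlt; apply/orP; left; apply/eqP; exact: lebesgue_rV_ball.
Qed.

(** Passage from almost everywhere to the point [x]: a strict excess at [x] would persist, by
    continuity of [v] and the Lipschitz bound on [w], on a whole cube, which has positive
    measure. *)
Lemma le_of_null_excess (v w : X -> R) (l B : R) x :
  {for x, continuous v} -> 0 < B -> (forall y, `|w x - w y| <= B * enorm (x - y)) ->
  measurable [set y | w y + l < v y] ->
  mu [set y | w y + l < v y] = 0%E -> v x <= w x + l.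
Proof.
move=> cv B0 wB mS S0; rewrite leNgt; apply/negP => wv.
have e0 : 0 < (v x - (w x + l)) / 2 by rewrite divr_gt0 // subr_gt0.
set e := _ / 2 in e0; have eE : 2 * e = v x - (w x + l) by rewrite /e; field.
have /nbhs_enormP[r1 r10 H1] : \forall y \near x, v x - e < v y.
  by apply: (cvgr_gt _ cv); lra.
have r0 : 0 < Num.min r1 (e / B) by rewrite lt_min r10 divr_gt0.
have /nbhs_ballP[b /= b0 bS] : nbhs x [set y | w y + l < v y].
  apply/nbhs_enormP; exists (Num.min r1 (e / B)) => // y.
  rewrite lt_min => /andP[/H1 vy]; rewrite ltr_pdivlMr // mulrC => wy /=.
  by have := le_lt_trans (wB y) wy; rewrite ltr_norml => /andP[? ?]; lra.
have := @le_measure _ _ _ mu _ _ (mem_set (measurable_rV_ball x b)) (mem_set mS) bS.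
rewrite [X in (_ <= X)%E](_ : _ = 0%E) //.
rewrite [X in (X <= _)%E](_ : _ = ((b *+ 2) ^+ d)%:E); last exact: lebesgue_rV_ball.
by rewrite lee_fin leNgt exprn_gt0 // pmulrn_lgt0.
Qed.

End Norms.

(** * The truncated cone as a barrier *)

Section Barrier.
Context {R : realType} {d : nat}.
Local Notation mu := (@lebesgue_rV R d).
Local Notation X := 'rV[R]_d.

Definition cone (r : R) (x0 x : X) : R := Num.min 1 (enorm (x0 - x) / r).

Lemma cone_ge0 r x0 x : 0 < r -> 0 <= cone r x0 x.
Proof. by move=> r0; rewrite le_min ler01 divr_ge0 ?enorm_ge0 // ltW. Qed.

Lemma cone_center r x0 : cone r x0 x0 = 0.
Proof. by rewrite /cone subrr (eqP (_ : enorm 0 == 0)) ?enorm_eq0 // mul0r min_r. Qed.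

Lemma cone_far r x0 x : 0 < r -> ~ enorm (x0 - x) < r -> cone r x0 x = 1.
Proof.
by move=> r0 /negP; rewrite -leNgt => h; rewrite /cone min_l // ler_pdivlMr // mul1r.
Qed.

Lemma cone_dist r x0 x y : 0 < r ->
  `|cone r x0 x - cone r x0 y| <= Num.min 1 (enorm (x - y) / r).
Proof.
move=> r0; rewrite le_min; apply/andP; split.
  have [hx hy] := (cone_ge0 x0 x r0, cone_ge0 x0 y r0).
  have [gx gy] : cone r x0 x <= 1 /\ cone r x0 y <= 1 by rewrite !ge_min !lexx.
  by rewrite ler_norml; lra.
have key (a b : R) : `|Num.min 1 a - Num.min 1 b| <= `|a - b|.
  rewrite /Num.min; case: ltP => ha; case: ltP => hb; rewrite ?subrr ?normr0 //;
  have := ler_norm (a - b); have := ler_norm (b - a); rewrite distrC => h1 h2;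
  rewrite ler_norml; lra.
apply: le_trans (key _ _) _.
rewrite -mulrBl normrM (gtr0_norm (_ : 0 < r^-1)) ?invr_gt0 // ler_pM2r ?invr_gt0 //.
apply: le_trans (enorm_distl _ _) _.
by rewrite opprB addrC addrA subrK enormB.
Qed.

Lemma measurable_cone r x0 : measurable_fun setT (cone r x0).
Proof.
apply: measurable_minr => //; apply: measurable_funM => //.
by apply: measurable_fun_enorm; exact: measurable_fun_rVB.
Qed.

(** For [r <= 1] one has [min 1 (t / r) <= (min 1 t) / r], so a cone of radius [r] costs only the
    factor [1 / r]. *)
Lemma cone_kernel_le (s L r : R) x0 x : 0 < r -> r <= 1 ->
  (forall x, \int[mu]_y (Num.min 1 (enorm (x - y)) * gagliardo_kernel s x y)%:E <= L%:E)%E ->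
  (\int[mu]_y (`|cone r x0 x - cone r x0 y| * gagliardo_kernel s x y)%:E <= (L / r)%:E)%E.
Proof.
move=> r0 r1 HL.
have mmin : measurable_fun setT (fun y : X => Num.min 1 (enorm (x - y))).
  apply: measurable_minr => //; apply: measurable_fun_enorm.
  exact: measurable_fun_rVB.
have mK : measurable_fun setT (gagliardo_kernel s x).
  exact: measurable_gagliardo_kernel.
apply: (@le_trans _ _ (\int[mu]_y
    ((r^-1)%:E * (Num.min 1%R (enorm (x - y)) * gagliardo_kernel s x y)%:E))%E).
  apply: ge0_le_integral => //.
  - by move=> y _; rewrite lee_fin mulr_ge0 ?gagliardo_kernel_ge0.
  - apply/measurable_EFinP; apply: measurable_funM => //.
    apply: measurableT_comp => //; apply: measurable_funB => //.
    exact: measurable_cone.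
  - by apply: measurable_funeM; apply/measurable_EFinP; exact: measurable_funM.
  move=> y _; rewrite -EFinM lee_fin mulrA ler_wpM2r ?gagliardo_kernel_ge0 //.
  apply: le_trans (cone_dist x0 x y r0) _.
  have := enorm_ge0 (x - y); move: (enorm _) => t t0.
  rewrite mulrC; have [t1|t1] := lerP 1 t.
    rewrite mulr1 ge_min; apply/orP; left.
    by rewrite invf_ge1.
  by rewrite ge_min lexx orbT.
rewrite ge0_integralZl_EFin ?invr_ge0 ?(ltW r0) //; last 2 first.
- by move=> y _; rewrite lee_fin mulr_ge0 ?gagliardo_kernel_ge0 // le_min ler01 enorm_ge0.
- by apply/measurable_EFinP; exact: measurable_funM.
by rewrite mulrC EFinM; apply: lee_wpmul2l => //; rewrite lee_fin invr_ge0 ltW.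
Qed.

End Barrier.

(** * Bounds at the vertex of a cone *)

Section PointwiseBounds.
Context {R : realType} {d : nat}.
Local Notation mu := (@lebesgue_rV R d).
Local Notation X := 'rV[R]_d.
Variables (s : R) (Omega D : set X).

Lemma energyE (alpha : R) (n u : X -> R) :
  energy s Omega D alpha n u =
  tracking_energy s alpha Omega (fun x => \1_D x + n x) u.
Proof.
by congr (_ + _)%E; apply: eq_integral => x _; rewrite opprD addrA.
Qed.

Lemma gagliardo_sqN (u : X -> R) : gagliardo_sq s (fun x => - u x) = gagliardo_sq s u.
Proof.
apply: eq_integral => x _; apply: eq_integral => y _.
by rewrite -opprD normrN.
Qed.

Lemma Hs0N (u : X -> R) : Hs0 s Omega u -> Hs0 s Omega (fun x => - u x).
Proof.
move=> [mu_ u0 Gu]; split; [exact: measurable_funN| |by rewrite gagliardo_sqN].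
by move=> x /u0 ->; rewrite oppr0.
Qed.

Lemma tracking_energyN (alpha : R) (f u : X -> R) :
  tracking_energy s alpha Omega (fun x => - f x) (fun x => - u x) =
  tracking_energy s alpha Omega f u.
Proof.
rewrite /tracking_energy gagliardo_sqN; congr (_ + _)%E.
by apply: eq_integral => x _; rewrite -opprD sqrrN.
Qed.

Hypotheses (d2 : (2 <= d)%N) (s0 : 0 < s) (s12 : s < 2^-1).
Hypotheses (oOmega : open Omega) (bOmega : bounded_set Omega) (oD : open D).
Hypothesis (DOmega : D `<=` Omega).
Variable q : R.
Hypothesis hq : d%:R / (2 * s) < q.

(** Both bounds come from [excess_set_null] with a cone at [x0]: the upper one for [u], the lower
    one for [- u] with data [- f]. The constants are fixed before [alpha], [N], [r] and the
    noise. *)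
Lemma minimizer_pointwise : exists L C : R, [/\ 0 < L, 0 < C &
  forall (alpha N r : R) (n u : X -> R) x0,
    0 < alpha -> 0 < N -> 0 < r -> r <= 1 ->
    Lp_dom 2%:E Omega n ->
    (Lp_norm q%:E n <= (alpha * N)%:E)%E ->
    is_continuous_minimizer s Omega D alpha n u -> Omega x0 ->
    ((forall y, enorm (x0 - y) < r -> ~ D y) -> u x0 <= 2 * alpha * (L / r) + C * N) /\
    ((forall y, enorm (x0 - y) < r -> D y) -> 1 - (2 * alpha * (L / r) + C * N) <= u x0)].
Proof.
have d0 : (0 < d)%N by exact: leq_trans d2.
have mO : measurable Omega by exact: open_measurable_rV.
have [V V0 OV] := bounded_measure_fin mO bOmega.
have O_fin : (mu Omega < +oo)%E by exact: le_lt_trans OV (ltry _).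
have [L L0 HL] := @gagliardo_kernel_lipschitz_le R d s d2 s0 s12.
have [c c0 HE] := @gagliardo_sq_ge_support R d s d0 s0.
(* From [2s < 1] and [d >= 2] one gets [d / (2s) >= 2]. *)
have q2 : 2 <= q.
  apply: ltW; apply: le_lt_trans hq; rewrite ler_pdivlMr ?mulr_gt0 //.
  have le4 (a b : R) : a < 2^-1 -> 2 <= b -> 2 * (2 * a) <= b by lra.
  by apply: le4; rewrite ?ler_nat.
have q0 : 0 < q by exact: lt_le_trans q2.
set dl := 4 * s / d%:R - 2 / q.
exists L, (6 / c * V `^ (dl / 2) * 2 `^ dl^-1).
split=> //; first by rewrite !mulr_gt0 ?powR_gt0 ?invr_gt0.
set C := _ * 2 `^ _.
move=> alpha N r n u x0 alpha0 N0 r0 r1 hn2 nN [[u_Hs0 u_min] cu] Ox0.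
have mn := measurable_Lp_dom hn2.
have mD : measurable_fun setT (\1_D : X -> R).
  by apply: measurable_indic; exact: open_measurable_rV.
pose f x := \1_D x + n x.
have mf : measurable_fun setT f by exact: measurable_funD.
have f2 : (\int[mu]_(x in Omega) (f x ^+ 2)%:E < +oo)%E.
  have mnO := measurable_funTS mn : measurable_fun Omega n.
  have mn2 : measurable_fun setT (fun x => n x ^+ 2) by exact: measurable_funX.
  apply: (@le_lt_trans _ _ (\int[mu]_(x in Omega) (2%:E * (1%:E + (n x ^+ 2)%:E)))%E).
    apply: ge0_le_integral => //.
    - by move=> x _; rewrite lee_fin sqr_ge0.
    - by apply/measurable_EFinP; apply: measurable_funX; exact: measurable_funTS.
    - apply: measurable_funeM; apply: emeasurable_funD => //.
      by apply/measurable_EFinP; exact: measurable_funTS.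
    move=> x _; rewrite -EFinD -EFinM lee_fin /f indicE.
    have := sqr_ge0 (n x); have := sqr_ge0 (1 - n x).
    by case: (x \in D); rewrite ?mulr1n ?mulr0n /=; lra.
  have mn2O : measurable_fun Omega (fun x => (n x ^+ 2)%:E).
    by apply/measurable_EFinP; exact: measurable_funTS.
  rewrite ge0_integralZl_EFin //; last 2 first.
  - by move=> x _; rewrite adde_ge0 // lee_fin sqr_ge0.
  - exact: emeasurable_funD.
  rewrite ge0_integralD //; last by move=> x _; rewrite lee_fin sqr_ge0.
  rewrite integral_cst // mul1e lte_mul_pinfty // lte_add_pinfty //.
  have [/sub_Lfun_finLfun + n0] := hn2; rewrite inE /= /finite_norm => n2fin.
  rewrite integral_support; last by move=> x /n0 ->; rewrite expr0n.
  have nf : (Lp_norm 2%:E n <= (fine (Lp_norm 2%:E n))%:E)%E.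
    by rewrite fineK // ge0_fin_numE // Lnorm_ge0.
  apply: le_lt_trans (le_lt_trans (integral_powR_le (ltr0n _ 2) nf) (ltry _)).
  apply: ge0_le_integral => //.
  - by move=> x _; rewrite lee_fin sqr_ge0.
  - exact/measurable_EFinP.
  - apply/measurable_EFinP; apply: (measurableT_comp (measurable_powR 2)).
    exact: measurableT_comp.
  by move=> x _; rewrite lee_fin powR_mulrn // real_normK // num_real.
have minf z : Hs0 s Omega z ->
    (tracking_energy s alpha Omega f u <= tracking_energy s alpha Omega f z)%E.
  by move=> /u_min; rewrite !energyE.
have mN := integral_powR_le q0 nN.
have Lr0 : 0 <= L / r by rewrite divr_ge0 ?ltW.
pose k := 2 * alpha * (L / r).
have k0 : 0 <= k by rewrite mulr_ge0 // mulr_ge0 // ltW.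
have mcone := @measurable_cone R d r x0.
have cone0 x : 0 <= cone r x0 x by exact: cone_ge0.
have cone_lip y : `|cone r x0 x0 - cone r x0 y| <= r^-1 * enorm (x0 - y).
  by apply: le_trans (cone_dist x0 x0 y r0) _; rewrite ge_min mulrC lexx orbT.
have coneL x := @cone_kernel_le R d s L r x0 x r0 r1 HL.
have c_u : {for x0, continuous u}.
  by move: cu; rewrite continuous_open_subspace // => /(_ x0); apply; rewrite inE.
have shift (a b e : R) : a + e - (b + e) = a - b by rewrite opprD addrACA subrr addr0.
split=> HD.
(* The lift [k] pays for the nonlocal term [2 alpha L / r]. On [D], which the ball misses, the cone
   equals 1 and so dominates the indicator; elsewhere the indicator is 0. *)
- pose w x := cone r x0 x + k.
  have mw : measurable_fun setT w by exact: measurable_funD.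
  have wL x : (\int[mu]_y (`|w x - w y| * gagliardo_kernel s x y)%:E <= (L / r)%:E)%E.
    by rewrite /w; under eq_integral do rewrite shift; exact: coneL.
  have w_ge0 x : 0 <= w x by rewrite addr_ge0.
  have w_super x : Omega x -> f x + 2 * alpha * (L / r) <= w x + `|n x|.
    move=> _; rewrite /f /w -/k; have := ler_norm (n x); rewrite indicE.
    have [xD|_] := boolP (x \in D); last by have := cone0 x; rewrite mulr0n; lra.
    rewrite cone_far //; first by rewrite mulr1n; lra.
    by move=> /HD; apply; rewrite inE in xD.
  have null := excess_set_null mO O_fin alpha0 mf f2 u_Hs0 minf mw mn Lr0 wL
    (fun x _ => w_ge0 x) (fun x => le_trans (lerN10 R) (w_ge0 x)) w_super c0 HE q2 N0 mN V0 OV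
    d0 s0 hq.
  have mE := measurable_excess_set u_Hs0 mw (C * N).
  have w_lip y : `|w x0 - w y| <= r^-1 * enorm (x0 - y) by rewrite /w shift.
  have ri0 : 0 < r^-1 by rewrite invr_gt0.
  have := le_of_null_excess c_u ri0 w_lip mE null.
  by rewrite /w cone_center add0r.
(* The data is now [-1] on [D] up to the noise, hence the barrier lowered by 1. Off [D], in
   particular off [Omega], the cone is 1 and [w = k >= 0], as required outside [Omega]. *)
- pose w x := cone r x0 x + (k - 1); pose v x := - u x.
  have v_Hs0 : Hs0 s Omega v by exact: Hs0N.
  have mf' : measurable_fun setT (fun x => - f x) by exact: measurable_funN.
  have f2' : (\int[mu]_(x in Omega) ((- f x) ^+ 2)%:E < +oo)%E.
    by under eq_integral do rewrite sqrrN.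
  have minf' z : Hs0 s Omega z ->
    (tracking_energy s alpha Omega (fun x => - f x)%R v <=
     tracking_energy s alpha Omega (fun x => - f x)%R z)%E.
    move=> /Hs0N/minf; rewrite /v tracking_energyN => /le_trans; apply.
    have := tracking_energyN alpha f (fun x => - z x).
    have -> : (fun x => - - z x) = z by apply/funext => x; rewrite opprK.
    by move=> ->.
  have mw : measurable_fun setT w by exact: measurable_funD.
  have wL x : (\int[mu]_y (`|w x - w y| * gagliardo_kernel s x y)%:E <= (L / r)%:E)%E.
    by rewrite /w; under eq_integral do rewrite shift; exact: coneL.
  have w_ext x : ~ Omega x -> 0 <= w x.
    move=> Ox; rewrite /w cone_far //; first by lra.
    by move=> /HD /DOmega.
  have w_ge x : -1 <= w x by rewrite /w; have := cone0 x; lra.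
  have w_super x : Omega x -> - f x + 2 * alpha * (L / r) <= w x + `|n x|.
    move=> _; rewrite /f /w -/k; have := ler_norm (- n x); rewrite normrN indicE.
    have [xD|xD] := boolP (x \in D); first by have := cone0 x; rewrite mulr1n; lra.
    rewrite cone_far //; first by rewrite mulr0n; lra.
    by move=> /HD; rewrite notin_setE in xD.
  have null := excess_set_null mO O_fin alpha0 mf' f2' v_Hs0 minf' mw mn Lr0 wL
    w_ext w_ge w_super c0 HE q2 N0 mN V0 OV d0 s0 hq.
  have mE := measurable_excess_set v_Hs0 mw (C * N).
  have c_v : {for x0, continuous v} by exact: continuousN.
  have w_lip y : `|w x0 - w y| <= r^-1 * enorm (x0 - y) by rewrite /w shift.
  have ri0 : 0 < r^-1 by rewrite invr_gt0.
  have := le_of_null_excess c_v ri0 w_lip mE null.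
  by rewrite /w /v cone_center add0r /k; lra.
Qed.

End PointwiseBounds.

(** * Lipschitz boundaries and level sets *)

Section Geometry.
Context {R : realType} {d : nat}.
Local Notation X := 'rV[R]_d.
Implicit Types (x y z p : X) (A D : set X).

(** A segment avoiding the boundary would meet the interior and the closure of [A] in the same set,
    both open and closed in the segment; by connectedness it would be the whole segment, [y]
    included. *)
Lemma segment_boundary A x y : A x -> ~ A y ->
  exists2 t : R, 0 <= t <= 1 & boundary A (x + t *: (y - x)).
Proof.
move=> Ax Ay; apply: contrapT => nb.
pose f (t : R) : X := x + t *: (y - x).
pose S : set X := f @` `[0, 1].
have Sb z : S z -> closure A z -> A° z.
  move=> [t /=]; rewrite in_itv /= => t01 <- cAz; apply: contrapT => iAz.
  by apply: nb; exists t.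
have cS : connected S.
  apply: connected_continuous_connected; first exact: segment_connected.
  apply: continuous_subspaceT => t; rewrite /f.
  by apply: cvgD; [exact: cvg_cst|apply: cvgZr_tmp; exact: cvg_id].
have Sx : S x by exists 0; rewrite /f /= ?in_itv /= ?lexx ?ler01 // scale0r addr0.
have Sy : S y.
  by exists 1; rewrite /f /= ?in_itv /= ?lexx ?ler01 // scale1r addrC subrK.
have SI : S `&` A° = S.
  apply: cS.
  - by exists x; split => //; apply: Sb => //; exact: subset_closure.
  - by exists A° => //; exact: open_interior.
  - exists (closure A); first exact: closed_closure.
    apply/seteqP; split=> z [Sz Az]; split=> //; last exact: Sb.
    exact: (subset_closure (interior_subset Az)).
have : (S `&` A°) y by rewrite SI.
by move=> [_ /interior_subset].
Qed.

Lemma ball_dichotomy D x (r : R) :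
  (forall y, boundary D y -> r <= enorm (x - y)) ->
  (forall y, enorm (x - y) < r -> D y) \/ (forall y, enorm (x - y) < r -> ~ D y).
Proof.
move=> Dr; have [Dx|Dx] := EM (D x); [left|right] => y xy.
- apply: contrapT => Dy; have [t /andP[t0 t1] /Dr] := segment_boundary Dx Dy.
  rewrite opprD addNKr enormN enormZ ger0_norm // enormB leNgt => /negP; apply.
  by apply: le_lt_trans xy; rewrite ler_piMl ?enorm_ge0.
- move=> Dy; have [t /andP[t0 t1] /Dr] := segment_boundary Dy Dx.
  rewrite opprD addrA -[X in X - _]scale1r -scalerBl enormZ ger0_norm ?subr_ge0 //.
  rewrite leNgt => /negP; apply; apply: le_lt_trans xy.
  by rewrite ler_piMl ?enorm_ge0 // gerBl.
Qed.

(** [H x] is the height of [x] above the graph of [g] in the direction [e]. *)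
Lemma lipschitz_graph_function (e : X) (g : X -> R) (L : R) : enorm e = 1 ->
  (forall x y, `|g x - g y| <= L * enorm (x - y)) ->
  exists2 M : R, 0 < M & exists H : X -> R, [/\
    (forall x, H x = dotrv x e - g (x - dotrv x e *: e)),
    (forall x y, `|H x - H y| <= M * enorm (x - y)) &
    (forall x t, H (x + t *: e) = H x + t)].
Proof.
move=> e1 gL; pose H x := dotrv x e - g (x - dotrv x e *: e).
have ee : dotrv e e = 1 by rewrite -enorm_sqr e1 expr1n.
have de x : `|dotrv x e| <= enorm x.
  rewrite ler_norml; apply/andP; split; last by have := dotrv_le x e; rewrite e1 mulr1.
  by have := dotrv_le (- x) e; rewrite dotrvNl enormN e1 mulr1; lra.
exists (1 + `|L| * 2); first by rewrite ltr_pwDl // mulr_ge0.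
exists H; split=> // [x y|x t]; last first.
  rewrite /H dotrvDl dotrvZl ee mulr1 scalerDl opprD addrACA subrr addr0.
  by rewrite addrAC.
have dB : dotrv x e - dotrv y e = dotrv (x - y) e by rewrite dotrvDl dotrvNl.
have -> : H x - H y = dotrv (x - y) e -
    (g (x - dotrv x e *: e) - g (y - dotrv y e *: e)) by rewrite /H -dB; ring.
apply: le_trans (ler_normB _ _) _; rewrite mulrDl mul1r lerD //.
apply: le_trans (gL _ _) _; apply: le_trans (ler_wpM2r (enorm_ge0 _) (ler_norm L)) _.
rewrite -mulrA ler_wpM2l //.
have -> : x - dotrv x e *: e - (y - dotrv y e *: e) = (x - y) - dotrv (x - y) e *: e.
  by rewrite -dB; apply/rowP => i; rewrite !mxE; ring.
apply: le_trans (enormD _ _) _; rewrite enormN enormZ e1 mulr1.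
by have := de (x - y); lra.
Qed.

(** A two-sided corkscrew condition at [x]. The same [C] bounds the distances and the range of
    scales, so the property weakens as [C] grows and a finite cover can share one constant. *)
Definition two_sided D (C : R) x := forall rho : R, 0 < rho -> C * rho <= 1 ->
  exists y z, [/\ enorm (x - y) <= C * rho, enorm (x - z) <= C * rho,
    (forall p, enorm (y - p) < rho -> D p) &
    (forall p, enorm (z - p) < rho -> ~ D p)].

(** Moving along the axis [e] changes the height [H] at unit rate, while [H] is [M]-Lipschitz; hence
    the balls of radius [rho] about [x + M rho e] and [x - M rho e] stay on either side of the
    graph. *)
Lemma lipschitz_boundary_local D x0 : lipschitz_boundary D -> boundary D x0 ->
  exists r C0 : R, [/\ 0 < r & forall C x, C0 <= C -> boundary D x ->
    enorm (x0 - x) < r -> two_sided D C x].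
Proof.
move=> DL Dx0; have [r [e [g [L [r0 e1 gL gD]]]]] := DL _ Dx0.
have [M M0 [H [HE HL Ht]]] := lipschitz_graph_function e1 gL.
have {}gD x : enorm (x - x0) < r -> (D x <-> 0 < H x).
  by move=> /gD; rewrite HE subr_gt0.
(* The summand [M] covers the distance from [x] to the centers; the other, through [C rho <= 1],
   gives [(M + 1) rho <= r / 4], which keeps both balls in the chart of radius [r]. *)
exists (r / 2), (M + (M + 1) * (4 / r)); split; first by rewrite divr_gt0.
move=> C x C0C [cDx iDx] x0x rho rho0 Crho.
(* A positive height would put [x] in the interior of [D], a negative one outside its closure. *)
have Hx : H x = 0.
  apply/eqP; rewrite eq_le; apply/andP; split; rewrite leNgt; apply/negP => Hx0.
  - have d0 : 0 < Num.min (r / 2) (H x / M) by rewrite lt_min !divr_gt0.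
    apply: iDx; apply/nbhs_enormP; exists (Num.min (r / 2) (H x / M)) => // p.
    rewrite lt_min => /andP[xp]; rewrite ltr_pdivlMr // => xpM.
    apply/gD.
      have := enorm_triangle x p x0; rewrite (enormB p x) (enormB x x0); lra.
    have := HL x p; rewrite ler_norml => /andP[_ h]; lra.
  - have d0 : 0 < Num.min (r / 2) (- H x / M) by rewrite lt_min !divr_gt0 // oppr_gt0.
    have : nbhs x [set p | enorm (x - p) < Num.min (r / 2) (- H x / M)].
      by apply/nbhs_enormP; exists (Num.min (r / 2) (- H x / M)).
    move=> /cDx[p [Dp /=]]; rewrite lt_min => /andP[xp]; rewrite ltr_pdivlMr // => xpM.
    have px0 : enorm (p - x0) < r.
      have := enorm_triangle x p x0; rewrite (enormB p x) (enormB x x0); lra.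
    have Hp := (gD p px0).1 Dp.
    have := HL x p; rewrite ler_norml => /andP[h _]; lra.
have r40 : 0 < 4 / r by rewrite divr_gt0.
have rhoM : (M + 1) * rho < r / 2.
  have : (M + 1) * (4 / r) * rho <= 1.
    apply: le_trans Crho; rewrite ler_wpM2r ?(ltW rho0) //.
    by apply: le_trans C0C; rewrite lerDr ltW.
  rewrite mulrAC mulrA ler_pdivrMr // mul1r; lra.
have MC : M * rho <= C * rho.
  rewrite ler_wpM2r ?(ltW rho0) //; apply: le_trans C0C.
  by rewrite lerDl mulr_ge0 ?(ltW r40) // addr_ge0 ?(ltW M0).
have Mr0 : 0 <= M * rho by rewrite mulr_ge0 ?ltW.
have ne (t : R) : enorm (x - (x + t *: e)) = `|t|.
  by rewrite opprD addNKr enormN enormZ e1 mulr1.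
have near_x (t : R) p : `|t| = M * rho -> enorm (x + t *: e - p) < rho ->
    enorm (p - x0) < r.
  move=> tM yp; have := enorm_triangle (x + t *: e) p x0.
  have := enorm_triangle x (x + t *: e) x0.
  rewrite (enormB p (x + _)) (enormB (x + _) x) ne tM (enormB x x0); lra.
exists (x + (M * rho) *: e), (x + (- (M * rho)) *: e).
rewrite !ne normrN ger0_norm //; split=> // p yp.
- apply/gD; first by apply: near_x yp; rewrite ger0_norm.
  have := HL (x + (M * rho) *: e) p; rewrite Ht Hx add0r ler_norml => /andP[_ h].
  have : M * enorm (x + (M * rho) *: e - p) < M * rho by rewrite ltr_pM2l.
  lra.
- have px0 : enorm (p - x0) < r by apply: near_x yp; rewrite normrN ger0_norm.
  move=> /(gD _ px0).
  have := HL (x + (- (M * rho)) *: e) p; rewrite Ht Hx add0r ler_norml => /andP[h _].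
  have : M * enorm (x + (- (M * rho)) *: e - p) < M * rho by rewrite ltr_pM2l.
  lra.
Qed.

Lemma compact_boundary D : bounded_set D -> compact (boundary D).
Proof.
move=> bD; apply: bounded_closed_compact; last first.
  apply: closedI; first exact: closed_closure.
  by apply: open_closedC; exact: open_interior.
have [M M0 DM] := ex_strict_bound_gt0 bD.
exists (M + 1); split; first exact: num_real.
move=> N MN x [cDx _] /=.
have [p [Dp xp]] := cDx _ (nbhsx_ballx x 1 ltr01).
have := DM _ Dp; move: xp; rewrite -ball_normE /= => xp pM.
have := ler_normD (x - p) p; rewrite subrK; lra.
Qed.

(** Compactness of the boundary in its filter form: each point has a neighborhood on which the
    condition holds for all large [C], hence all large [C] serve the whole boundary. *)
Lemma lipschitz_boundary_two_sided D : bounded_set D -> lipschitz_boundary D ->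
  exists2 C : R, 0 < C & forall x, boundary D x -> two_sided D C x.
Proof.
move=> bD DL; have /compact_near_coveringP cov := compact_boundary bD.
have /(_ _)[] := cov R (pinfty_nbhs R) (fun C x => boundary D x -> two_sided D C x) _.
  move=> x0 Dx0; have [r [C0 [r0 HC]]] := lipschitz_boundary_local DL Dx0.
  exists ([set x | enorm (x0 - x) < r], [set C | C0 < C]) => /=.
    split; first by apply/nbhs_enormP; exists r.
    by exists C0; split; [exact: num_real|].
  by move=> [x C] /= [x0x CC] Dx; apply: HC => //; exact: ltW.
move=> M [_ HM]; exists (Num.max 1 (M + 1)); first by rewrite lt_max ltr01.
move=> x Dx; apply: (HM (Num.max 1 (M + 1)) _ x Dx Dx).
by rewrite lt_max ltrDl ltr01 orbT.
Qed.

End Geometry.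

(** * Smallness thresholds *)

Section Small.
Context {R : realType}.

Lemma powR_small (p b : R) : 0 < p -> 0 < b ->
  exists2 a : R, 0 < a & forall x, 0 < x -> x <= a -> x `^ p <= b.
Proof.
move=> p0 b0; exists (b `^ p^-1); first by rewrite powR_gt0.
move=> x x0 xb; rewrite -[leRHS](powRr1 (ltW b0)) -[X in b `^ X](mulVf (lt0r_neq0 p0)) powRrM.
by apply: ge0_ler_powR; rewrite ?nnegrE ?powR_ge0 ?(ltW p0) ?(ltW x0).
Qed.

(** The finitely many [alpha k] with [k < K] have a positive lower bound. A property of late indices
    thus becomes a property of small [alpha]. *)
Lemma small_index (alpha : nat -> R) (K : nat) : (forall k, 0 < alpha k) ->
  exists2 a : R, 0 < a & forall k, alpha k <= a -> (K <= k)%N.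
Proof.
move=> alpha0; elim: K => [|K [a a0 IH]]; first by exists 1.
exists (Num.min a (alpha K / 2)); first by rewrite lt_min a0 divr_gt0.
move=> k; rewrite le_min => /andP[/IH Kk kK].
rewrite ltn_neqAle Kk andbT; apply/eqP => E; move: kK; rewrite -E.
by have := alpha0 K; lra.
Qed.

End Small.

(** * From pointwise bounds to the Hausdorff distance *)

Theorem theorem2 (R : realType) (d : nat) (s q : R) (Omega D : set 'rV[R]_d)
    (alpha : nat -> R) (n u : nat -> 'rV[R]_d -> R)
    (hd : (2 <= d)%N)
    (hs : 0 < s < 2^-1)
    (hq : d%:R / (2 * s) < q)
    (hOmega : bounded_domain Omega)
    (hOmegaLip : lipschitz_boundary Omega)
    (hOmegaBall : exterior_ball_condition Omega)
    (hD : open D)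
    (hDOmega : D `<=` Omega)
    (hDLip : lipschitz_boundary D)
    (hDdist : (0 < ereal_inf
       [set dist_set x (boundary Omega) | x in boundary D])%E)
    (halpha_gt0 : forall k, 0 < alpha k)
    (halpha : alpha k @[k --> \oo] --> 0)
    (hn2 : forall k, Lp_dom 2%:E Omega (n k))
    (hnq : forall k, Lp_dom q%:E Omega (n k))
    (hn2_cvg : Lp_norm 2%:E (n k) @[k --> \oo] --> 0%E)
    (hnq_cvg : (Lp_norm q%:E (n k) * ((alpha k)^-1)%:E)%E @[k --> \oo] --> 0%E)
    (hu : forall k, is_continuous_minimizer s Omega D (alpha k) (n k) (u k)) :
  exists C : R, 0 < C /\
    forall theta : R, 0 < theta < 1 ->
    exists alpha0 : R, 0 < alpha0 /\
      forall k, alpha k <= alpha0 ->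
        (hausdorff (boundary [set x | (theta < u k x)%R]) (boundary D) <=
         (C * Num.max theta^-1 (1 - theta)^-1
                `^ Num.min (2 / d%:R) (1 / (2 * s))
            * alpha k `^ (1 / d%:R))%:E)%E.
Proof.
have [s0 s12] := andP hs; have [oO _ _ bO] := hOmega.
have dR : 2 <= d%:R :> R by rewrite ler_nat.
have bD : bounded_set D.
  by apply: sub_boundedr bO => A; apply: subset_trans; exact: hDOmega.
have [CD CD0 HD] := lipschitz_boundary_two_sided bD hDLip.
have [L [C1 [L0 C10 pw]]] := minimizer_pointwise hd s0 s12 oO bO hD hDOmega hq.
(* [CD] serves the points of the boundary of [D], the added 1 those of the boundary of the level
   set. The choice precedes [theta]. *)
exists (CD + 1); split; first by rewrite addr_gt0.
move=> theta /andP[t0 t1].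
pose eta := Num.min theta (1 - theta).
have eta0 : 0 < eta by rewrite lt_min t0 subr_gt0.
have [etat eta1t] : eta <= theta /\ eta <= 1 - theta by rewrite !ge_min !lexx orbT.
(* Makes the noise term [C1 * N] equal to [eta / 4]. *)
pose N := eta / (4 * C1).
have N0 : 0 < N by rewrite divr_gt0 // mulr_gt0.
have [K HK] : exists K, forall k, (K <= k)%N ->
    (Lp_norm q%:E (n k) <= (alpha k * N)%:E)%E.
  have /fine_cvgP[fin cvg0] := hnq_cvg.
  have [K _ HK] := filterI fin (cvgr_lt _ cvg0 N N0).
  exists K => k /HK[] /=; have := halpha_gt0 k.
  have : (0 <= Lp_norm q%:E (n k))%E by exact: Lnorm_ge0.
  case: (Lp_norm _ _) => [r| |] //= r0 a0; last by rewrite mulyr gtr0_sg ?invr_gt0 ?mul1e.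
  by move=> _; rewrite ltr_pdivrMr // lee_fin => /ltW; rewrite mulrC.
have [a1 a10 Ha1] := small_index K halpha_gt0.
have dV : 0 < d%:R^-1 :> R by rewrite invr_gt0; lra.
(* The lift of the cone is of order [alpha / rho = alpha^(1 - 1/d)], small because [d >= 2]. *)
have dV1 : 0 < 1 - d%:R^-1 :> R.
  by rewrite subr_gt0 invf_lt1; lra.
have [a2 a20 Ha2] := powR_small dV (@ltr01 R).
have CDi : 0 < CD^-1 by rewrite invr_gt0.
have [a3 a30 Ha3] := powR_small dV CDi.
have e16 : 0 < eta / (16 * L) by rewrite divr_gt0 // mulr_gt0.
have [a4 a40 Ha4] := powR_small dV1 e16.
(* [a1] places the index beyond [K], where the noise is bounded; [a2] gives [rho <= 1], [a3] gives
   [CD * rho <= 1], and [a4] makes the lift at most [eta / 4]. *)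
exists (Num.min (Num.min a1 a2) (Num.min a3 a4)); split.
  by rewrite !lt_min a10 a20 a30 a40.
move=> k; rewrite !le_min => /andP[/andP[/Ha1/HK nk /Ha2 ak2] /andP[/Ha3 ak3 /Ha4 ak4]].
have ak0 := halpha_gt0 k; move: (ak2 ak0) (ak3 ak0) (ak4 ak0) => {}ak2 {}ak3 {}ak4.
rewrite (div1r d%:R); set rho := alpha k `^ d%:R^-1 in ak2 ak3 *.
have rho0 : 0 < rho by rewrite powR_gt0.
have r0 : 0 < rho / 2 by rewrite divr_gt0.
have r1 : rho / 2 <= 1 by lra.
have small : 2 * alpha k * (L / (rho / 2)) + C1 * N <= eta / 2.
  have -> : C1 * N = eta / 4 by rewrite /N; field; rewrite gt_eqF.
  have -> : 2 * alpha k * (L / (rho / 2)) = 4 * L * alpha k `^ (1 - d%:R^-1).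
    rewrite powRB; last by rewrite (gt_eqF ak0) implybT.
    by rewrite powRr1 ?(ltW ak0) // -/rho; field; rewrite gt_eqF.
  have : 4 * L * alpha k `^ (1 - d%:R^-1) <= 4 * L * (eta / (16 * L)).
    by rewrite ler_wpM2l // mulr_ge0 // ltW.
  have -> : 4 * L * (eta / (16 * L)) = eta / 4 by field; rewrite gt_eqF.
  by lra.
have u_out x : (forall y, enorm (x - y) < rho / 2 -> ~ D y) -> u k x <= theta.
  move=> xD; have [Ox|Ox] := EM (Omega x); last first.
    by have [[[_ u0 _] _] _] := hu k; rewrite u0 // ltW.
  have [/(_ xD) h _] := pw _ _ _ _ _ _ ak0 N0 r0 r1 (hn2 k) nk (hu k) Ox.
  by lra.
have u_in x : (forall y, enorm (x - y) < rho / 2 -> D y) -> theta < u k x.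
  move=> xD; have Dx : D x by apply: xD; rewrite subrr (eqP (_ : enorm 0 == 0)) ?enorm_eq0.
  have [_ /(_ xD) h] := pw _ _ _ _ _ _ ak0 N0 r0 r1 (hn2 k) nk (hu k) (hDOmega _ Dx).
  by lra.
set B := _ * rho.
(* The base is at least 1 and the exponent nonnegative, so [(CD + 1) * rho] lies below the claimed
   bound [B]. *)
have M1 : 1 <= Num.max theta^-1 (1 - theta)^-1 `^ Num.min (2 / d%:R) (1 / (2 * s)).
  rewrite -[leLHS](powRr0 (Num.max theta^-1 (1 - theta)^-1)); apply: ler_powR.
    by rewrite le_max invf_ge1 // (ltW t1).
  by rewrite le_min !divr_ge0 //; lra.
have B1 : (CD + 1) * rho <= B.
  by rewrite /B ler_wpM2r ?(ltW rho0) // ler_peMr // ltW // addr_gt0.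
(* If [x] were farther than [B >= rho] from the boundary of [D], its [rho]-ball would lie in [D] or
   miss [D]. Each point within [rho / 2] of [x] would inherit this at radius [rho / 2], so [u] would
   stay on one side of [theta] near [x]. *)
have Bin x : boundary [set x | theta < u k x] x -> (dist_set x (boundary D) <= B%:E)%E.
  move=> [cx ix]; rewrite leNgt; apply/negP => Bx.
  have far y : boundary D y -> rho <= enorm (x - y).
    move=> Dy; rewrite -lee_fin; apply: (@le_trans _ _ B%:E).
      by rewrite lee_fin; apply: le_trans B1; rewrite ler_peMl ?(ltW rho0) // lerDr ltW.
    by apply: (le_trans (ltW Bx)); apply: ereal_inf_lbound; exists y.
  have sub x' y : enorm (x - x') < rho / 2 -> enorm (x' - y) < rho / 2 ->
      enorm (x - y) < rho.
    by move=> ? ?; have := enorm_triangle x' x y; lra.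
  have [inD|outD] := ball_dichotomy far.
  - apply: ix; apply/nbhs_enormP; exists (rho / 2) => // x' xx'; apply: u_in => y x'y.
    by apply: inD; exact: sub x'y.
  - have /cx[x' [/= ux' xx']] : nbhs x [set x' | enorm (x - x') < rho / 2].
      by apply/nbhs_enormP; exists (rho / 2).
    move: ux'; rewrite ltNge u_out // => y x'y.
    by apply: outD; exact: sub x'y.
have Bout y : boundary D y ->
    (dist_set y (boundary [set x | (theta < u k x)%R]) <= B%:E)%E.
  move=> Dy; have rC : CD * (rho / 2) <= 1.
    have : CD * rho <= CD * CD^-1 by rewrite ler_wpM2l // ltW.
    rewrite mulfV ?gt_eqF //; have := mulr_gt0 CD0 rho0; lra.
  have [p [z [yp yz /u_in up /u_out uz]]] := HD _ Dy _ r0 rC.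
  have nz : ~ [set x | theta < u k x] z by rewrite /= ltNge uz.
  have [t /andP[t0' t1'] bt] := segment_boundary (up : [set x | theta < u k x] p) nz.
  apply: (@le_trans _ _ (enorm (y - (p + t *: (z - p))))%:E).
    by apply: ereal_inf_lbound; exists (p + t *: (z - p)).
  rewrite lee_fin.
  (* The crossing point is a convex combination of [p] and [z], hence no farther from [y] than
     [CD * (rho / 2)]. *)
  have -> : y - (p + t *: (z - p)) = (1 - t) *: (y - p) + t *: (y - z).
    by apply/rowP => i; rewrite !mxE; ring.
  apply: le_trans (enormD _ _) _; rewrite !enormZ !ger0_norm ?subr_ge0 //.
  apply: le_trans B1.
  have h1 : (1 - t) * enorm (y - p) <= (1 - t) * (CD * (rho / 2)).
    by rewrite ler_wpM2l // subr_ge0.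
  have h2 : t * enorm (y - z) <= t * (CD * (rho / 2)) by rewrite ler_wpM2l.
  have := mulr_gt0 CD0 rho0; lra.
rewrite /hausdorff ge_max; apply/andP; split; apply: ub_ereal_sup => _ [x bx <-].
- exact: Bin.
- exact: Bout.
Qed.
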